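(* Let $\phi$ satisfy $\cos\phi\neq0$. Let $\Sigma$ be an arbitrary minimal surface in $\mathbb{R}^n$, let $\check\mu$ be a harmonic $1$-form on $\Sigma$, and let $m:\mathbb{R}\to\mathbb{R}$ be a linear (i.e. affine) function with derivative $-\tan\phi$. Then the cylinder $M=\Sigma\times\mathbb{R}\subset\mathbb{R}^{n+1}$, together with $\mu=\check\mu+m(t)\,dt$, where $t$ is the coordinate on the second factor, forms a twisted-austere pair (with phase $e^{i\theta}$, where $\theta=\phi+(n-2)\frac{\pi}{2}$).
   Context: Identify $T^*\mathbb{R}^N$ with $\mathbb{C}^N$ via $(x,\sum_j y_j\,dx_j)\leftrightarrow (z_j=x_j+iy_j)$. An $N$-dimensional submanifold $L\subset\mathbb{C}^N$ is special Lagrangian with phase $e^{i\theta}$ if both $\sum_j dx_j\wedge dy_j$ and $\operatorname{Im}(e^{i\theta}dz_1\wedge\cdots\wedge dz_N)$ restrict to zero on $L$. For a submanifold $M\subset\mathbb{R}^N$ and a smooth $1$-form $\mu$ on $M$, using $T^*\mathbb{R}^N|_M=T^*M\oplus N^*M$ set $N^*M+\mu=\{(x,\xi+\mu_x): x\in M,\ \xi\in N^*_xM\}$. The pair $(M,\mu)$ is twisted-austere (with phase $e^{i\theta}$) if $N^*M+\mu$ is special Lagrangian (with phase $e^{i\theta}$). Here $N=n+1$, $\dim M=3$, and the cophase is $\phi=\theta-(N-3)\frac{\pi}{2}=\theta-(n-2)\frac{\pi}{2}$. It is a known fact (Karigiannis-Leung) that, with $B=\nabla\mu$, $C=I+iB$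 and $A^\nu=\nu\cdot\mathrm{II}$ (matrices in an orthonormal tangent frame), this is equivalent to: $d\mu=0$, $\operatorname{Im}(e^{i\phi}\det C)=0$, and $\operatorname{Im}(i^j\sigma_j(A^\nu C^{-1}))=0$ for all normal $\nu$ and $j=1,2,3$, where $\sigma_j$ is the $j$-th elementary symmetric function of the eigenvalues. Harmonic means closed and coclosed with respect to the induced metric on $\Sigma$; $\check\mu$ also denotes its pullback to $M$. *)

(* Defs.v *)
From HB Require Import structures.
From mathcomp Require Import all_boot all_order all_algebra.
From mathcomp Require Import all_classical all_reals all_analysis.
From mathcomp Require complex.

Set Implicit Arguments.
Unset Strict Implicit.
Unset Printing Implicit Defensive.

Import Order.TTheory GRing.Theory Num.Theory.
Import numFieldNormedType.Exports.

Local Open Scope classical_set_scope.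
Local Open Scope ring_scope.

(* R^N is 'rV[R]_N.  Both vectors and covectors of R^N are row vectors: a
   covector is given by its components in dx_1, ..., dx_N, so that evaluating
   it on a vector is the dot product. *)
Definition dotv (R : realType) (N : nat) (a b : 'rV[R]_N) : R :=
  \sum_(j < N) a 0 j * b 0 j.

Section Smoothness.
Variable R : realType.

Definition partial (k N : nat) (i : 'I_k) (f : 'rV[R]_k -> 'rV[R]_N)
    : 'rV[R]_k -> 'rV[R]_N :=
  fun u => 'D_(delta_mx 0 i) f u.

Definition partialR (k : nat) (i : 'I_k) (f : 'rV[R]_k -> R)
    : 'rV[R]_k -> R :=
  fun u => 'D_(delta_mx 0 i : 'rV[R]_k) f u.

(* C^r on an open set U. *)
Fixpoint Cr_on (k N r : nat) (U : set 'rV[R]_k) (f : 'rV[R]_k -> 'rV[R]_N)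
    : Prop :=
  match r with
  | 0 => forall u, U u -> {for u, continuous f}
  | r'.+1 => (forall u, U u -> differentiable f u) /\
             (forall i : 'I_k, Cr_on r' U (partial i f))
  end.

(* A map defined on an arbitrary subset A of R^k is C^oo when it extends,
   around each point of A, to a C^oo map on an open subset of R^k. *)
Definition smooth_on (k N : nat) (A : set 'rV[R]_k)
    (f : 'rV[R]_k -> 'rV[R]_N) : Prop :=
  forall p, A p -> exists (W : set 'rV[R]_k) (F : 'rV[R]_k -> 'rV[R]_N),
    [/\ open W, W p, (forall r, Cr_on r W F) &
        forall x, A x -> W x -> F x = f x].

End Smoothness.

Section Submanifolds.
Variables (R : realType) (k N : nat).
Implicit Types (M : set 'rV[R]_N) (V : set 'rV[R]_k) (f : 'rV[R]_k -> 'rV[R]_N).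

(* f restricts to a diffeomorphism from the open set V of R^k onto a relatively
   open subset of M, with inverse g. *)
Definition local_param M V f : Prop :=
  [/\ open V, smooth_on V f &
      exists (W : set 'rV[R]_N) (g : 'rV[R]_N -> 'rV[R]_k),
        [/\ open W, f @` V = M `&` W, smooth_on (M `&` W) g &
            forall u, V u -> g (f u) = u]].

Definition submanifold M : Prop :=
  forall p, M p -> exists V f, local_param M V f /\ (f @` V) p.

Definition tangent M (p : 'rV[R]_N) : set 'rV[R]_N :=
  [set v | exists V f u w,
     [/\ local_param M V f, V u, f u = p & v = 'd f u w]].

(* The annihilator of T_pM in T_p^*R^N; through the Euclidean metric this is
   also the normal space. *)
Definition conormal M (p : 'rV[R]_N) : set 'rV[R]_N :=
  [set xi | forall v, tangent M p v -> dotv xi v = 0].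

(* T^*M sits in the restriction of T^*R^N to M as the summand complementary to
   N^*M, i.e. as the covectors vanishing on normal vectors.  A 1-form on M is a
   smooth section of it; its values off M are irrelevant. *)
Definition one_form M (mu : 'rV[R]_N -> 'rV[R]_N) : Prop :=
  smooth_on M mu /\
  (forall p, M p -> forall nu, conormal M p nu -> dotv (mu p) nu = 0).

(* 'J f u has rows \partial_i f (u). *)
Definition first_ff f (u : 'rV[R]_k) : 'M[R]_k := 'J f u *m ('J f u)^T.

Definition normal_proj f (u : 'rV[R]_k) : 'M[R]_N :=
  1%:M - ('J f u)^T *m invmx (first_ff f u) *m 'J f u.

Definition second_ff f (u : 'rV[R]_k) (i j : 'I_k) : 'rV[R]_N :=
  partial i (partial j f) u *m normal_proj f u.

(* Trace of the second fundamental form, without the factor 1/k. *)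
Definition mean_curvature f (u : 'rV[R]_k) : 'rV[R]_N :=
  \sum_(i < k) \sum_(j < k) invmx (first_ff f u) i j *: second_ff f u i j.

Definition minimal M : Prop :=
  submanifold M /\
  (forall V f, local_param M V f -> forall u, V u -> mean_curvature f u = 0).

(* The coefficient mu(\partial_i f) of du_i in the pullback of mu by f. *)
Definition coef f (mu : 'rV[R]_N -> 'rV[R]_N) (i : 'I_k) (u : 'rV[R]_k) : R :=
  dotv (mu (f u)) (partial i f u).

Definition closed_form M (mu : 'rV[R]_N -> 'rV[R]_N) : Prop :=
  forall V f, local_param M V f -> forall u, V u ->
  forall i j : 'I_k,
    partialR i (coef f mu j) u = partialR j (coef f mu i) u.

(* In the coordinates u, with g the induced metric, d^* mu is
   - (det g)^(-1/2) \sum_i \partial_i ((det g)^(1/2) \sum_j g^{ij} mu_j). *)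
Definition coclosed_form M (mu : 'rV[R]_N -> 'rV[R]_N) : Prop :=
  forall V f, local_param M V f -> forall u, V u ->
    \sum_(i < k) partialR i (fun u' =>
       Num.sqrt (\det (first_ff f u')) *
       \sum_(j < k) invmx (first_ff f u') i j * coef f mu j u') u = 0.

Definition harmonic_form M (mu : 'rV[R]_N -> 'rV[R]_N) : Prop :=
  [/\ one_form M mu, closed_form M mu & coclosed_form M mu].

End Submanifolds.

Arguments submanifold {R} k {N} M.
Arguments tangent {R} k {N} M p.
Arguments conormal {R} k {N} M p.
Arguments one_form {R} k {N} M mu.
Arguments minimal {R} k {N} M.
Arguments closed_form {R} k {N} M mu.
Arguments coclosed_form {R} k {N} M mu.
Arguments harmonic_form {R} k {N} M mu.

Section SpecialLagrangian.
Import complex.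
Variable R : realType.

Definition expi (t : R) : R[i] := Complex (cos t) (sin t).

(* C^N is R^(N + N): the row vector (x, y) stands for z = x + i y, and for the
   covector \sum_j y_j dx_j at x. *)
Definition dx (N : nat) (j : 'I_N) (v : 'rV[R]_(N + N)) : R := lsubmx v 0 j.
Definition dy (N : nat) (j : 'I_N) (v : 'rV[R]_(N + N)) : R := rsubmx v 0 j.
Definition dz (N : nat) (j : 'I_N) (v : 'rV[R]_(N + N)) : R[i] :=
  Complex (dx j v) (dy j v).

(* \sum_j dx_j /\ dy_j *)
Definition kahler_form (N : nat) (v w : 'rV[R]_(N + N)) : R :=
  \sum_(j < N) (dx j v * dy j w - dx j w * dy j v).

(* dz_1 /\ ... /\ dz_N *)
Definition holo_volume (N : nat) (v : 'I_N -> 'rV[R]_(N + N)) : R[i] :=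
  \det (\matrix_(i < N, j < N) dz j (v i)).

Definition special_lagrangian (N : nat) (theta : R) (L : set 'rV[R]_(N + N))
    : Prop :=
  submanifold N L /\
  (forall p, L p ->
     (forall v w, tangent N L p v -> tangent N L p w -> kahler_form v w = 0) /\
     (forall v : 'I_N -> 'rV[R]_(N + N), (forall i, tangent N L p (v i)) ->
        complex.Im (expi theta * holo_volume v) = 0)).

(* N^*M + mu *)
Definition twisted_conormal (k N : nat) (M : set 'rV[R]_N)
    (mu : 'rV[R]_N -> 'rV[R]_N) : set 'rV[R]_(N + N) :=
  [set p | exists x xi,
     [/\ M x, conormal k M x xi & p = row_mx x (xi + mu x)]].

(* The pair (M, mu), with dim M = k, is twisted-austere with phase
   e^(i theta). *)
Definition twisted_austere (k N : nat) (theta : R) (M : set 'rV[R]_N)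
    (mu : 'rV[R]_N -> 'rV[R]_N) : Prop :=
  [/\ submanifold k M, one_form k M mu &
      special_lagrangian theta (twisted_conormal k M mu)].

End SpecialLagrangian.

Arguments twisted_austere {R} k {N} theta M mu.

Section Cylinder.
Variables (R : realType) (n : nat).

(* A point (x, t) of R^n x R = R^(n + 1) has x = lsubmx p and t = tcoord p. *)
Definition tcoord (p : 'rV[R]_(n + 1)) : R := rsubmx p 0 0.

Definition cylinder (S : set 'rV[R]_n) : set 'rV[R]_(n + 1) :=
  [set p | S (lsubmx p)].

(* mu + m(t) dt, where mu is pulled back by the projection (x, t) |-> x. *)
Definition cylinder_form (mu : 'rV[R]_n -> 'rV[R]_n) (m : R -> R)
    : 'rV[R]_(n + 1) -> 'rV[R]_(n + 1) :=
  fun p => row_mx (mu (lsubmx p)) (m (tcoord p))%:M.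

End Cylinder.

(* Main.v *)
(* Let f parametrize Sigma with metric G, let J be its Jacobian, and let
   sigma = nu + mu o f where nu is a normal field.  The tangent space of
   N^*M + mu is spanned by the vectors (d_i f, d_i sigma) and (0, normal) of the
   surface factor and by (1, - tan phi) in the last copy of C.  Multiplying the
   resulting complex matrix by a real invertible one reduces its determinant to
     i^(n - 2) (1 - i tan phi) det (G + i H),   H_ij = d_i sigma . d_j f.
   Since sigma . d_j f = mu (d_j f), one has
     H_ij = d_i (mu (d_j f)) - sigma . d_i d_j f,
   which is symmetric because mu is closed, and trace-free with respect to G
   because Sigma is minimal and mu is coclosed.  Hence N^*M + mu is Lagrangian
   and det (G + i H) is real, while
   e^(i phi) (1 - i tan phi) = 1 / cos phi.  The phase e^(i (n - 2) pi / 2)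
   turns i^(n - 2) into (-1)^(n - 2). *)

(* The matrix [H] is the coordinate form of the covariant derivative of [mu] minus [nu . II]: since
   [mu] is tangential, the part [mu . d_i d_j f] of [sigma . d_i d_j f] is the Christoffel term. So
   its trace splits into the divergence of [mu] and the pairing of [nu] with the mean curvature.
   Dimension two enters through [det (G + i H) = det G - det H + i det G tr (G^-1 H)]: the trace
   alone controls the imaginary part.

   The obstacle is that [N^*M + mu] must be shown to be a submanifold, which asks for a smooth
   normal frame whose coefficients can be read back smoothly. One splitting of [R^n], adapted to the
   tangent plane at a single point, is kept fixed; its second half is corrected to be normal at
   nearby points, and a constant matrix [K0] returns the coefficients. The same [K0], set beside
   [J^T], gives the real invertible matrix of the overview. Freezing the frame coefficients makes
   [sigma] a field on the surface, and differentiating [sigma . d_j f = mu (d_j f)] yields [H]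
   without computing any derivative of the frame. *)
Require Import Defs.
From mathcomp Require Import all_boot all_order all_algebra.
From mathcomp Require Import all_classical all_reals all_analysis.
From mathcomp Require Import ring.
From mathcomp Require complex.
Import Order.TTheory GRing.Theory Num.Theory.
Import numFieldNormedType.Exports.
Set Implicit Arguments.
Unset Strict Implicit.
Unset Printing Implicit Defensive.
Local Open Scope classical_set_scope.
Local Open Scope ring_scope.

(** * Smooth functions *)

Section Calculus.
Variable R : realType.

Lemma near_eq_differentiable (V W : normedModType R) (f g : V -> W) a :
  (\near a, f a = g a) -> differentiable f a -> differentiable g a.
Proof.
move=> fg df.
have fa : f a = g a by apply: nbhs_singleton fg.
have cf : continuous ('d f a) by exact: diff_continuous.
have fgs : \forall h \near (0 : V), f (h + a) = g (h + a).
  by rewrite (near_shift a) /=; apply: filterS fg => x /=; rewrite sub0r subrK.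
have E : g \o shift a = cst (g a) + 'd f a +o_ 0 id.
  apply/eqaddoP => e e0.
  have /eqaddoP/(_ _ e0) := diff_locally df.
  apply: filter_app; near=> h.
  rewrite -![(_ - _ : _ -> _) _]/(_ - _) -![(_ + _ : _ -> _) _]/(_ + _) /=.
  rewrite /cst -fa.
  suff -> : f (h + a) = g (h + a) by [].
  by near: h.
have dE := diff_unique cf E.
by apply/diff_locallyP; rewrite dE.
Unshelve. all: by end_near. Qed.

Lemma differentiable_rowP (k N : nat) (f : 'rV[R]_k -> 'rV[R]_N) u :
  differentiable f u <-> forall j, differentiable (fun x => f x 0 j) u.
Proof.
split=> [df j|df].
  by apply: (@differentiable_comp _ _ _ _ f (fun x : 'rV[R]_N => x 0 j)) => //;
     exact: differentiable_coord.
have -> : f = \sum_(j < N) (fun x => f x 0 j *: (delta_mx 0 j : 'rV[R]_N)).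
  by apply/funext => x; rewrite fct_sumE {1}(row_sum_delta (f x)).
by apply: differentiable_sum => j; apply: differentiableZl.
Qed.

Lemma continuous_rowP (k N : nat) (f : 'rV[R]_k -> 'rV[R]_N) u :
  {for u, continuous f} <-> forall j, {for u, continuous (fun x => f x 0 j)}.
Proof.
split=> [df j|df].
  by apply: (@continuous_comp _ _ _ f (fun x : 'rV[R]_N => x 0 j)) => //;
     exact: coord_continuous.
have -> : f = fun x => \sum_(j < N) (f x 0 j *: (delta_mx 0 j : 'rV[R]_N)).
  by apply/funext => x; rewrite {1}(row_sum_delta (f x)).
rewrite /continuous_at.
have FF : Filter (nbhs u) := nbhs_filter u.
by apply: (cvg_big add_continuous FF) => j _; apply: cvgZr_tmp; exact: df.
Qed.

Lemma derive_coord (k N : nat) (f : 'rV[R]_k -> 'rV[R]_N) u v j :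
  differentiable f u -> ('D_v f u) 0 j = 'D_v (fun x => f x 0 j) u.
Proof. by move=> df; rewrite derive_mx ?mxE//; apply: diff_derivable. Qed.

Lemma open_near (V : normedModType R) (U : set V) (P : V -> Prop) u :
  open U -> U u -> (forall x, U x -> P x) -> \near u, P u.
Proof.
by move=> oU Uu UP; apply: filterS UP _; apply: open_nbhs_nbhs.
Qed.

(** Scalar counterpart of [Cr_on]: products and inverses are handled here, and [Cr_rowP] transfers
    the results to row vectors coordinate by coordinate. *)
Fixpoint Cs_on (k r : nat) (U : set 'rV[R]_k) (a : 'rV[R]_k -> R) : Prop :=
  match r with
  | 0 => forall u, U u -> {for u, continuous a}
  | r'.+1 => (forall u, U u -> differentiable a u) /\
             (forall i : 'I_k, Cs_on r' U (partialR i a))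
  end.

Section Scalar.
Variables (k : nat) (U : set 'rV[R]_k).
Hypothesis oU : open U.
Implicit Types (r : nat) (a b : 'rV[R]_k -> R).

(** On an open set, agreeing functions have agreeing derivatives of every order. The closure lemmas
    below rest on this, because the product, quotient and chain rules identify a partial derivative
    only on [U]. *)
Lemma Cs_ext r a b : (forall u, U u -> a u = b u) ->
  Cs_on r U a -> Cs_on r U b.
Proof.
elim: r a b => [|r IH] a b ab /=.
  move=> ca u Uu; have cau : a x @[x --> u] --> a u := ca u Uu.
  have E : \near u, a u = b u by exact: (open_near oU Uu).
  rewrite /prop_for /continuous_at -(ab u Uu); apply: (cvg_trans _ cau).
  exact: (@near_eq_cvg _ _ _ (nbhs_filter u) a b E).
move=> [da pa]; split=> [u Uu|i].
  by apply: near_eq_differentiable (da u Uu); exact: (open_near oU Uu).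
apply: IH (pa i) => u Uu; apply: near_eq_derive.
exact: (open_near oU Uu).
Qed.

Lemma Cs_lower r a : Cs_on r.+1 U a -> Cs_on r U a.
Proof.
elim: r a => [|r IH] a [da pa]; first by move=> u /da/differentiable_continuous.
by split=> // i; apply: IH.
Qed.

Lemma Cs_cst r (c : R) : Cs_on r U (fun=> c).
Proof.
elim: r c => [|r IH] c.
  move=> u _; exact: (@cvg_cst _ c _ _ (nbhs_filter u)).
split=> [u _|i]; first exact: differentiable_cst.
have -> : partialR i (fun=> c) = fun=> 0 by apply/funext => u; exact: derive_cst.
exact: IH.
Qed.

Lemma CsD r a b : Cs_on r U a -> Cs_on r U b -> Cs_on r U (fun u => a u + b u).
Proof.
elim: r a b => [|r IH] a b.
  move=> ca cb u Uu.
  exact: (@cvgD _ _ _ _ (nbhs_filter u) _ _ _ _ (ca u Uu) (cb u Uu)).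
move=> [da pa] [db pb]; split=> [u Uu|i].
  by apply: (differentiableD (da u Uu) (db u Uu)).
apply: Cs_ext (IH _ _ (pa i) (pb i)) => u Uu.
by rewrite /partialR deriveD//; apply: diff_derivable; [exact: da|exact: db].
Qed.

Lemma CsM r a b : Cs_on r U a -> Cs_on r U b -> Cs_on r U (fun u => a u * b u).
Proof.
elim: r a b => [|r IH] a b.
  move=> ca cb u Uu.
  exact: (@cvgM _ _ _ (nbhs_filter u) _ _ _ _ (ca u Uu) (cb u Uu)).
move=> Ca Cb; have [[da pa] [db pb]] := (Ca, Cb); split=> [u Uu|i].
  by apply: (differentiableM (da u Uu) (db u Uu)).
apply: Cs_ext (CsD (IH _ _ (Cs_lower Ca) (pb i)) (IH _ _ (Cs_lower Cb) (pa i))).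
move=> u Uu.
by rewrite /partialR deriveM//; apply: diff_derivable; [exact: da|exact: db].
Qed.

Lemma Cs_coord r j : Cs_on r U (fun u => u 0 j).
Proof.
case: r => [|r]; first by move=> u _; exact: coord_continuous.
split=> [u _|i]; first exact: differentiable_coord.
have -> : partialR i (fun u : 'rV[R]_k => u 0 j) =
    fun=> (delta_mx 0 i : 'rV[R]_k) 0 j.
  apply/funext => u; rewrite /partialR -(@derive_coord _ _ id); last first.
    exact: ex_diff.
  by rewrite derive_id.
exact: Cs_cst.
Qed.

Lemma CsV r a : (forall u, U u -> a u != 0) ->
  Cs_on r U a -> Cs_on r U (fun u => (a u)^-1).
Proof.
move=> a0; elim: r => [|r IH].
  by move=> ca u Uu; apply: (@cvgV _ _ _ (nbhs_filter u) _ _ (a0 u Uu) (ca u Uu)).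
move=> Ca; have [da pa] := Ca; split=> [u Uu|i].
  by apply: (differentiableV (da u Uu) (a0 u Uu)).
have Cv := IH (Cs_lower Ca).
apply: Cs_ext (CsM (CsM (Cs_cst _ (-1)) (CsM Cv Cv)) (pa i)) => u Uu.
rewrite /partialR deriveV//; last 2 first.
- exact: a0.
- by apply: diff_derivable; exact: da.
by rewrite /GRing.scale/= mulN1r expr2 invfM.
Qed.

Lemma Cs_sum r (I : Type) (s : seq I) (P : pred I) (F : I -> 'rV[R]_k -> R) :
  (forall i, P i -> Cs_on r U (F i)) ->
  Cs_on r U (fun u => \sum_(i <- s | P i) F i u).
Proof.
move=> CF; elim: s => [|i s IH].
  by apply: Cs_ext (Cs_cst _ 0) => u _; rewrite big_nil.
case Pi : (P i).
  by apply: Cs_ext (CsD (CF i Pi) IH) => u _; rewrite big_cons Pi.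
by apply: Cs_ext IH => u _; rewrite big_cons Pi.
Qed.

End Scalar.

Lemma Cs_sub (k r : nat) (U V : set 'rV[R]_k) a :
  V `<=` U -> Cs_on r U a -> Cs_on r V a.
Proof.
move=> VU; elim: r a => [|r IH] a; first by move=> ca u Vu; exact: (ca u (VU u Vu)).
move=> [da pa]; split=> [u Vu|i]; first exact: (da u (VU u Vu)).
exact: IH (pa i).
Qed.

Lemma Cr_sub (k N r : nat) (U V : set 'rV[R]_k) (f : 'rV[R]_k -> 'rV[R]_N) :
  V `<=` U -> Cr_on r U f -> Cr_on r V f.
Proof.
move=> VU; elim: r f => [|r IH] a; first by move=> ca u Vu; exact: (ca u (VU u Vu)).
move=> [da pa]; split=> [u Vu|i]; first exact: (da u (VU u Vu)).
exact: IH (pa i).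
Qed.

Lemma Cr_rowP (k N r : nat) (U : set 'rV[R]_k) (f : 'rV[R]_k -> 'rV[R]_N) :
  open U -> Cr_on r U f <-> forall j, Cs_on r U (fun u => f u 0 j).
Proof.
move=> oU; elim: r f => [|r IH] f /=.
  split=> [cf j u /cf/continuous_rowP//|cf u Uu].
  by apply/continuous_rowP => j; exact: cf.
split=> [[df pf] j|cf].
  split=> [u /df/differentiable_rowP//|i].
  move/IH: (pf i) => /(_ j); apply: Cs_ext => // u Uu.
  by rewrite /partial derive_coord//; exact: df.
have df u : U u -> differentiable f u.
  by move=> Uu; apply/differentiable_rowP => j; apply: (cf j).1.
split=> // i; apply/IH => j.
apply: Cs_ext ((cf j).2 i) => // u Uu.
by rewrite /partial derive_coord//; exact: df.
Qed.

(** Induction on [r] through the chain rule: a partial derivative of the composite is a sum of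
    products of a partial of [f] with a partial of [a] composed with [f], each factor being one
    order less smooth. *)
Lemma Cs_comp (k N r : nat) (U : set 'rV[R]_k) (W : set 'rV[R]_N)
    (f : 'rV[R]_k -> 'rV[R]_N) (a : 'rV[R]_N -> R) :
  open U -> open W -> (forall u, U u -> W (f u)) ->
  Cr_on r U f -> Cs_on r W a -> Cs_on r U (a \o f).
Proof.
move=> oU oW UW; elim: r a => [|r IH] a.
  by move=> cf ca u Uu; apply: continuous_comp; [exact: cf|exact/ca/UW].
move=> Cf [da pa]; have [df pf] := Cf; split=> [u Uu|i].
  by apply: differentiable_comp; [exact: df|exact/da/UW].
have Cf' : Cr_on r U f.
  by apply/Cr_rowP => // j; apply: Cs_lower => //; move: j; apply/Cr_rowP.
have pfi : forall j, Cs_on r U (fun u => partial i f u 0 j).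
  exact: (Cr_rowP _ _ oU).1 (pf i).
apply: (@Cs_ext _ _ oU _
  (fun u => \sum_(j < N) partial i f u 0 j * (partialR j a \o f) u)).
  move=> u Uu; rewrite /partialR deriveE; last first.
    by apply: differentiable_comp; [exact: df|exact/da/UW].
  rewrite diff_comp; [|exact: df|exact/da/UW].
  rewrite /comp -[X in _ = 'd a _ X]deriveE; last exact: df.
  rewrite [X in _ = 'd a _ X]row_sum_delta linear_sum.
  apply: eq_bigr => j _; rewrite linearZ /partialR deriveE//.
  exact/da/UW.
apply: (Cs_sum oU) => j _; apply: (CsM oU (pfi j)).
exact: IH Cf' (pa j).
Qed.

Lemma Cr_comp (k N M r : nat) (U : set 'rV[R]_k) (W : set 'rV[R]_N)
    (f : 'rV[R]_k -> 'rV[R]_N) (g : 'rV[R]_N -> 'rV[R]_M) :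
  open U -> open W -> (forall u, U u -> W (f u)) ->
  Cr_on r U f -> Cr_on r W g -> Cr_on r U (g \o f).
Proof.
move=> oU oW UW Cf /Cr_rowP Cg; apply/Cr_rowP => // j.
exact: (Cs_comp oU oW UW Cf (Cg oW j)).
Qed.

End Calculus.

(** * Smoothness on arbitrary subsets, by local extension *)

Section Smooth.
Variable R : realType.

Lemma Cr_ext (k N r : nat) (U : set 'rV[R]_k) (f g : 'rV[R]_k -> 'rV[R]_N) :
  open U -> (forall u, U u -> f u = g u) -> Cr_on r U f -> Cr_on r U g.
Proof.
move=> oU fg Cf; apply/(Cr_rowP _ _ oU) => j.
by apply: (Cs_ext oU _ ((Cr_rowP _ _ oU).1 Cf j)) => u /fg ->.
Qed.

Lemma Cr_local (k N r : nat) (U : set 'rV[R]_k) (f : 'rV[R]_k -> 'rV[R]_N) :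
  (forall p, U p -> exists W, W p /\ Cr_on r W f) -> Cr_on r U f.
Proof.
elim: r f => [|r IH] f H; first by move=> p /H[W [Wp Cf]]; exact: Cf.
split=> [p /H[W [Wp [df _]]]|i]; first exact: df.
apply: IH => p /H[W [Wp [_ pf]]]; exists W; split=> //; exact: pf.
Qed.

Lemma smooth_onP (k N : nat) (U : set 'rV[R]_k) (f : 'rV[R]_k -> 'rV[R]_N) :
  open U -> smooth_on U f <-> forall r, Cr_on r U f.
Proof.
move=> oU; split=> [sf r|Cf p Up]; last by exists U, f.
apply: Cr_local => p Up; have [W [F [oW Wp CF Ff]]] := sf p Up.
exists (U `&` W); split=> //.
have oUW : open (U `&` W) by exact: openI.
have UW : U `&` W `<=` W by move=> ? [].
by apply: (Cr_ext oUW _ (Cr_sub UW (CF r))) => u [Uu Wu]; exact: Ff.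
Qed.

Lemma open_preimage_on (V W : normedModType R) (U : set V) (O : set W)
    (f : V -> W) : open U -> (forall u, U u -> {for u, continuous f}) ->
  open O -> open (U `&` f @^-1` O).
Proof.
move=> oU cf oO; rewrite openE => u [Uu Ofu]; apply: filterI.
  exact: open_nbhs_nbhs.
exact: (cf u Uu O (open_nbhs_nbhs (conj oO Ofu))).
Qed.

Lemma Cr_continuous (k N : nat) (U : set 'rV[R]_k) (f : 'rV[R]_k -> 'rV[R]_N) :
  (forall r, Cr_on r U f) -> forall u, U u -> {for u, continuous f}.
Proof. by move=> Cf; exact: (Cf 0%N). Qed.

Lemma Cr_differentiable (k N : nat) (U : set 'rV[R]_k)
    (f : 'rV[R]_k -> 'rV[R]_N) :
  (forall r, Cr_on r U f) -> forall u, U u -> differentiable f u.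
Proof. by move=> Cf; exact: (Cf 1%N).1. Qed.

Lemma smooth_on_ext (k N : nat) (A : set 'rV[R]_k) (f g : 'rV[R]_k -> 'rV[R]_N) :
  (forall x, A x -> f x = g x) -> smooth_on A f -> smooth_on A g.
Proof.
move=> fg sf p Ap; have [W [F [oW Wp CF Ff]]] := sf p Ap.
by exists W, F; split=> // x Ax Wx; rewrite Ff// fg.
Qed.

Lemma smooth_on_sub (k N : nat) (A B : set 'rV[R]_k) (f : 'rV[R]_k -> 'rV[R]_N) :
  A `<=` B -> smooth_on B f -> smooth_on A f.
Proof.
move=> AB sf p /AB Bp; have [W [F [oW Wp CF Ff]]] := sf p Bp.
by exists W, F; split=> // x /AB; exact: Ff.
Qed.

Lemma smooth_on_comp (k N M : nat) (A : set 'rV[R]_k) (B : set 'rV[R]_N)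
    (f : 'rV[R]_k -> 'rV[R]_N) (g : 'rV[R]_N -> 'rV[R]_M) :
  (forall x, A x -> B (f x)) -> smooth_on A f -> smooth_on B g ->
  smooth_on A (g \o f).
Proof.
move=> AB sf sg p Ap; have [W [F [oW Wp CF Ff]]] := sf p Ap.
have [W' [G [oW' W'p CG Gg]]] := sg _ (AB p Ap).
have oWW : open (W `&` F @^-1` W').
  by apply: open_preimage_on => //; exact: Cr_continuous.
exists (W `&` F @^-1` W'), (G \o F); split=> //.
- by split=> //=; rewrite Ff.
- move=> r; have WW : W `&` F @^-1` W' `<=` W by move=> ? [].
  by apply: (Cr_comp oWW oW' _ (Cr_sub WW (CF r)) (CG r)) => u [].
- move=> x Ax [Wx /= W'x]; rewrite Ff// in W'x *.
  exact: Gg (AB x Ax) W'x.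
Qed.

Definition smoothR_on (k : nat) (A : set 'rV[R]_k) (a : 'rV[R]_k -> R) : Prop :=
  forall p, A p -> exists (W : set 'rV[R]_k) (F : 'rV[R]_k -> R),
    [/\ open W, W p, (forall r, Cs_on r W F) &
        forall x, A x -> W x -> F x = a x].

Lemma smooth_rowP (k N : nat) (A : set 'rV[R]_k) (f : 'rV[R]_k -> 'rV[R]_N) :
  smooth_on A f <-> forall j, smoothR_on A (fun u => f u 0 j).
Proof.
split=> [sf j p Ap|sf p Ap].
  have [W [F [oW Wp CF Ff]]] := sf p Ap.
  exists W, (fun x => F x 0 j); split=> // [r|x Ax Wx]; last by rewrite Ff.
  exact: (Cr_rowP _ _ oW).1 (CF r) j.
have /choice[WF HWF] : forall j, exists WF : set 'rV[R]_k * ('rV[R]_k -> R),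
    [/\ open WF.1, WF.1 p, (forall r, Cs_on r WF.1 WF.2) &
        forall x, A x -> WF.1 x -> WF.2 x = f x 0 j].
  by move=> j; have [W [F H]] := sf j p Ap; exists (W, F).
(* Each coordinate has its own extension on its own neighbourhood. There are finitely many
   coordinates, so the common domain is still a neighbourhood of [p]. *)
pose W := interior [set x | forall j, (WF j).1 x].
have WS j : W `<=` (WF j).1.
  by move=> x /interior_subset /= /(_ j).
have oW : open W by exact: open_interior.
exists W, (fun x => \row_j (WF j).2 x); split=> //.
- rewrite /W /interior /=; have FF : Filter (nbhs p) := nbhs_filter p.
  apply: (@filter_forall _ _ (fun j x => (WF j).1 x) _ FF) => j.
  have [oj pj _ _] := HWF j.
  exact: (open_nbhs_nbhs (conj oj pj)).
- move=> r; apply/Cr_rowP => // j; have [_ _ Cj _] := HWF j.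
  apply: (Cs_ext oW _ (Cs_sub (WS j) (Cj r))) => u _.
  by rewrite mxE.
- move=> x Ax Wx; apply/rowP => j; rewrite mxE; have [_ _ _ E] := HWF j.
  by apply: E => //; exact: WS.
Qed.

Section SmoothR.
Variables (k : nat) (A : set 'rV[R]_k).
Implicit Types a b : 'rV[R]_k -> R.

Lemma smoothR_ext a b : (forall x, A x -> a x = b x) ->
  smoothR_on A a -> smoothR_on A b.
Proof.
move=> fg sf p Ap; have [W [F [oW Wp CF Ff]]] := sf p Ap.
by exists W, F; split=> // x Ax Wx; rewrite Ff// fg.
Qed.

Lemma smoothR_cst (c : R) : smoothR_on A (fun=> c).
Proof.
move=> p Ap; exists setT, (fun=> c); split=> //; first exact: openT.
by move=> r; apply: Cs_cst; exact: openT.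
Qed.

Lemma smoothR_coord j : smoothR_on A (fun u => u 0 j).
Proof.
move=> p Ap; exists setT, (fun u => u 0 j); split=> //; first exact: openT.
by move=> r; apply: Cs_coord; exact: openT.
Qed.

Lemma smoothRD a b : smoothR_on A a -> smoothR_on A b ->
  smoothR_on A (fun u => a u + b u).
Proof.
move=> sa sb p Ap; have [W [F [oW Wp CF Ff]]] := sa p Ap.
have [W' [G [oW' W'p CG Gg]]] := sb p Ap.
have oWW := openI oW oW'.
exists (W `&` W'), (fun u => F u + G u); split=> //.
  by move=> r; apply: (CsD oWW); [apply: Cs_sub (CF r)|apply: Cs_sub (CG r)];
    move=> ? [].
by move=> x Ax [Wx W'x]; rewrite Ff// Gg.
Qed.

Lemma smoothRM a b : smoothR_on A a -> smoothR_on A b ->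
  smoothR_on A (fun u => a u * b u).
Proof.
move=> sa sb p Ap; have [W [F [oW Wp CF Ff]]] := sa p Ap.
have [W' [G [oW' W'p CG Gg]]] := sb p Ap.
have oWW := openI oW oW'.
exists (W `&` W'), (fun u => F u * G u); split=> //.
  by move=> r; apply: (CsM oWW); [apply: Cs_sub (CF r)|apply: Cs_sub (CG r)];
    move=> ? [].
by move=> x Ax [Wx W'x]; rewrite Ff// Gg.
Qed.

Lemma smoothRV a : (forall x, A x -> a x != 0) -> smoothR_on A a ->
  smoothR_on A (fun u => (a u)^-1).
Proof.
move=> a0 sa p Ap; have [W [F [oW Wp CF Ff]]] := sa p Ap.
have oWW : open (W `&` F @^-1` [set x | x != 0]).
  apply: open_preimage_on => //; first exact: (CF 0%N).
exists (W `&` F @^-1` [set x | x != 0]), (fun u => (F u)^-1); split=> //.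
- by split=> //=; rewrite Ff// a0.
- move=> r; apply: (CsV oWW); first by move=> u [].
  by apply: Cs_sub (CF r); move=> ? [].
- by move=> x Ax [Wx W'x]; rewrite Ff.
Qed.

Lemma smoothRN a : smoothR_on A a -> smoothR_on A (fun u => - a u).
Proof.
move=> sa; apply: smoothR_ext (smoothRM (smoothR_cst (-1)) sa) => x _.
by rewrite mulN1r.
Qed.

Lemma smoothR_sum (I : Type) (s : seq I) (P : pred I) (F : I -> 'rV[R]_k -> R) :
  (forall i, P i -> smoothR_on A (F i)) ->
  smoothR_on A (fun u => \sum_(i <- s | P i) F i u).
Proof.
move=> CF; elim: s => [|i s IH].
  by apply: smoothR_ext (smoothR_cst 0) => u _; rewrite big_nil.
case Pi : (P i).
  by apply: smoothR_ext (smoothRD (CF i Pi) IH) => u _; rewrite big_cons Pi.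
by apply: smoothR_ext IH => u _; rewrite big_cons Pi.
Qed.

Lemma smoothR_prod (I : Type) (s : seq I) (P : pred I) (F : I -> 'rV[R]_k -> R) :
  (forall i, P i -> smoothR_on A (F i)) ->
  smoothR_on A (fun u => \prod_(i <- s | P i) F i u).
Proof.
move=> CF; elim: s => [|i s IH].
  by apply: smoothR_ext (smoothR_cst 1) => u _; rewrite big_nil.
case Pi : (P i).
  by apply: smoothR_ext (smoothRM (CF i Pi) IH) => u _; rewrite big_cons Pi.
by apply: smoothR_ext IH => u _; rewrite big_cons Pi.
Qed.

Definition smooth_mx p q (B : 'rV[R]_k -> 'M[R]_(p, q)) :=
  forall i j, smoothR_on A (fun u => B u i j).

Lemma smooth_mx_cst p q (C : 'M[R]_(p, q)) : smooth_mx (fun=> C).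
Proof. by move=> i j; exact: smoothR_cst. Qed.

Lemma smooth_mxM p q s (B : 'rV[R]_k -> 'M[R]_(p, q)) (C : _ -> 'M[R]_(q, s)) :
  smooth_mx B -> smooth_mx C -> smooth_mx (fun u => B u *m C u).
Proof.
move=> sB sC i j.
apply: (@smoothR_ext (fun u => \sum_l B u i l * C u l j)).
  by move=> u _; rewrite mxE.
by apply: smoothR_sum => l _; exact: smoothRM.
Qed.

Lemma smooth_mxD p q (B C : 'rV[R]_k -> 'M[R]_(p, q)) :
  smooth_mx B -> smooth_mx C -> smooth_mx (fun u => B u + C u).
Proof.
move=> sB sC i j; apply: smoothR_ext (smoothRD (sB i j) (sC i j)) => u _.
by rewrite mxE.
Qed.

Lemma smooth_mxN p q (B : 'rV[R]_k -> 'M[R]_(p, q)) :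
  smooth_mx B -> smooth_mx (fun u => - B u).
Proof.
by move=> sB i j; apply: smoothR_ext (smoothRN (sB i j)) => u _; rewrite mxE.
Qed.

Lemma smooth_mxT p q (B : 'rV[R]_k -> 'M[R]_(p, q)) :
  smooth_mx B -> smooth_mx (fun u => (B u)^T).
Proof.
by move=> sB i j; apply: smoothR_ext (sB j i) => u _; rewrite mxE.
Qed.

Lemma smooth_det p (B : 'rV[R]_k -> 'M[R]_p) :
  smooth_mx B -> smoothR_on A (fun u => \det (B u)).
Proof.
move=> sB; apply: smoothR_sum => s _; apply: smoothRM; first exact: smoothR_cst.
by apply: smoothR_prod => i _; exact: sB.
Qed.

(** Cramer's rule: the entries are cofactors divided by the determinant, hence quotients of
    polynomials in the entries of [B]. *)
Lemma smooth_invmx p (B : 'rV[R]_k -> 'M[R]_p) :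
  (forall u, A u -> B u \in unitmx) -> smooth_mx B ->
  smooth_mx (fun u => invmx (B u)).
Proof.
move=> uB sB i j.
have sd : smoothR_on A (fun u => (\det (B u))^-1).
  apply: smoothRV (smooth_det sB) => u /uB; by rewrite unitmxE unitfE.
have sc : smoothR_on A (fun u => cofactor (B u) j i).
  apply: smoothRM; first exact: smoothR_cst.
  apply: smooth_det => a b.
  by apply: smoothR_ext (sB (lift j a) (lift i b)) => u _; rewrite !mxE.
by apply: smoothR_ext (smoothRM sd sc) => u Au; rewrite /invmx uB// !mxE.
Qed.

Lemma smooth_mx_row N (f : 'rV[R]_k -> 'rV[R]_N) :
  smooth_on A f <-> smooth_mx f.
Proof.
split=> [/smooth_rowP sf i j|sf]; first by rewrite ord1.
by apply/smooth_rowP => j; exact: sf.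
Qed.

End SmoothR.

Lemma smooth_linear (k N : nat) (A : set 'rV[R]_k) (C : 'M[R]_(k, N)) :
  smooth_on A (fun u => u *m C).
Proof.
apply/smooth_mx_row; apply: smooth_mxM (@smooth_mx_cst _ _ _ _ _).
by move=> i j; rewrite ord1; exact: smoothR_coord.
Qed.

Lemma smooth_lsubmx (k N : nat) (A : set 'rV[R]_(k + N)) :
  smooth_on A (@lsubmx R 1 k N).
Proof.
apply: smooth_on_ext (@smooth_linear _ _ _ (lsubmx 1%:M)) => x _.
by rewrite mulmx_lsub mulmx1.
Qed.

Lemma smooth_rsubmx (k N : nat) (A : set 'rV[R]_(k + N)) :
  smooth_on A (@rsubmx R 1 k N).
Proof.
apply: smooth_on_ext (@smooth_linear _ _ _ (rsubmx 1%:M)) => x _.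
by rewrite mulmx_rsub mulmx1.
Qed.

Lemma smooth_row_mx (k N M : nat) (A : set 'rV[R]_k) (f : 'rV[R]_k -> 'rV[R]_N)
    (g : 'rV[R]_k -> 'rV[R]_M) : smooth_on A f -> smooth_on A g ->
  smooth_on A (fun u => row_mx (f u) (g u)).
Proof.
move=> /smooth_rowP sf /smooth_rowP sg; apply/smooth_rowP => j.
by case: (split_ordP j) => i ->; [apply: smoothR_ext (sf i)|apply: smoothR_ext (sg i)];
  move=> x _; rewrite ?row_mxEl ?row_mxEr.
Qed.

Lemma smooth_mx_comp (k N p q : nat) (A : set 'rV[R]_k) (B : set 'rV[R]_N)
    (f : 'rV[R]_k -> 'rV[R]_N) (C : 'rV[R]_N -> 'M[R]_(p, q)) :
  (forall x, A x -> B (f x)) -> smooth_on A f -> smooth_mx B C ->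
  smooth_mx A (fun u => C (f u)).
Proof.
move=> AB sf sC i j.
have sr : smooth_on B (fun x => row i (C x)).
  by apply/smooth_rowP => l; apply: smoothR_ext (sC i l) => x _; rewrite !mxE.
have /smooth_rowP/(_ j) := smooth_on_comp AB sf sr.
by apply: smoothR_ext => x _; rewrite !mxE.
Qed.

Lemma smooth_partial (k N : nat) (V : set 'rV[R]_k) (f : 'rV[R]_k -> 'rV[R]_N) i :
  open V -> smooth_on V f -> smooth_on V (partial i f).
Proof.
move=> oV /(smooth_onP _ oV) Cf; apply/(smooth_onP _ oV) => r.
exact: (Cf r.+1).2.
Qed.

Lemma row_jacobian (k N : nat) (f : 'rV[R]_k -> 'rV[R]_N) u i :
  differentiable f u -> row i ('J f u) = partial i f u.
Proof. by move=> df; rewrite /partial deriveEjacobian// rowE. Qed.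

Lemma smooth_jacobian (k N : nat) (V : set 'rV[R]_k) (f : 'rV[R]_k -> 'rV[R]_N) :
  open V -> smooth_on V f -> smooth_mx V (fun u => 'J f u).
Proof.
move=> oV sf i j; have /smooth_rowP/(_ j) := smooth_partial i oV sf.
apply: smoothR_ext => u Vu; rewrite -row_jacobian ?mxE//.
by move/(smooth_onP _ oV): sf => /Cr_differentiable; exact.
Qed.

End Smooth.

(** * Symmetry of second derivatives *)

Section Schwarz.
Variables (R : realType) (k : nat).
Implicit Types (f : 'rV[R]_k -> R) (a v w : 'rV[R]_k).

Lemma is_derive_line f a v (s : R) : differentiable f (a + s *: v) ->
  is_derive s 1 (fun t : R => f (a + t *: v)) ('D_v f (a + s *: v)).
Proof.
move=> df.
have E : (fun h : R => h^-1 *: (((fun t : R => f (a + t *: v)) \o shift s) (h *: 1)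
      - f (a + s *: v))) =
    (fun h : R => h^-1 *: ((f \o shift (a + s *: v)) (h *: v) - f (a + s *: v))).
  apply/funext => h /=; congr (_ *: (f _ - _)).
  by rewrite /shift /= [h *: 1]mulr1 scalerDl addrCA addrA addrC addrA.
apply: DeriveDef; last by rewrite /derive E.
by rewrite /derivable E; apply: diff_derivable.
Qed.

Lemma MVT_closed (g dg : R -> R) (t : R) : 0 < t ->
  (forall s, 0 <= s <= t -> is_derive s 1 g (dg s)) ->
  exists2 c, 0 <= c <= t & g t - g 0 = dg c * t.
Proof.
move=> t0 dgs; have [x xt||c] := @MVT R g dg 0 t t0.
- by apply: dgs; move: xt; rewrite in_itv /= => /andP[/ltW -> /ltW ->].
- apply: derivable_within_continuous => x; rewrite in_itv /= => xt.
  by have [] := dgs x xt.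
by rewrite in_itv /= subr0 => /andP[/ltW c0 /ltW ct] E; exists c; rewrite ?c0.
Qed.

(** The mean value theorem in direction [v], applied to the difference of [f] along two parallel
    segments, and then in direction [w], turns the second difference into [t ^+ 2] times the mixed
    derivative at an intermediate point. Continuity at [a] does the rest. *)
Lemma second_difference (U : set 'rV[R]_k) f a v w : open U -> U a ->
  (forall u, U u -> differentiable f u) ->
  (forall u, U u -> differentiable ('D_v f) u) ->
  {for a, continuous ('D_w ('D_v f))} ->
  forall e : R, 0 < e -> exists2 d : R, 0 < d & forall t, 0 < t < d ->
    `|f (a + t *: v + t *: w) - f (a + t *: v) - (f (a + t *: w) - f a) -
      'D_w ('D_v f) a * t ^+ 2| <= e * t ^+ 2.
Proof.
move=> oU Ua df dDf cD e e0.
have /nbhs_normP[r /= r0 Br] : nbhs a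
    [set x | U x /\ `|'D_w ('D_v f) a - 'D_w ('D_v f) x| < e].
  have FF : Filter (nbhs a) := nbhs_filter a.
  apply: filterI; first exact: open_nbhs_nbhs.
  by move/cvgrPdist_lt : cD; apply.
(* This keeps the whole parallelogram spanned by [t *: v] and [t *: w] in the ball of radius [r];
   the summand 1 makes the denominator positive even if [v] and [w] vanish. *)
exists (r / (`|v| + `|w| + 1)) => [|t /andP[t0 tr]].
  by rewrite divr_gt0// ltr_wpDl// addr_ge0.
have trv : t * (`|v| + `|w| + 1) < r.
  by rewrite -ltr_pdivlMr// ltr_wpDl// addr_ge0.
have inB (x y : R) : 0 <= x <= t -> 0 <= y <= t ->
    U (a + x *: v + y *: w) /\
    `|'D_w ('D_v f) a - 'D_w ('D_v f) (a + x *: v + y *: w)| < e.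
  move=> /andP[x0 xt] /andP[y0 yt]; apply: Br => /=.
  rewrite -addrA opprD addrA subrr add0r normrN.
  apply: le_lt_trans trv; apply: le_trans (ler_normD _ _) _.
  rewrite !normrZ !ger0_norm// !mulrDr mulr1 -[leLHS]addr0.
  by rewrite !lerD// ?ler_wpM2r// ltW.
have t_in : 0 <= t <= t by rewrite lexx ltW.
have z_in : 0 <= (0 : R) <= t by rewrite lexx ltW.
have /(MVT_closed t0)[c c_in] : forall s, 0 <= s <= t -> is_derive s (1 : R)
    ((fun s => f (a + t *: w + s *: v)) - (fun s => f (a + s *: v)))
    ('D_v f (a + t *: w + s *: v) - 'D_v f (a + s *: v)).
  move=> s s_in; apply: is_deriveB; apply: is_derive_line; apply: df.
    by rewrite addrAC; have [] := inB s t s_in t_in.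
  by have [] := inB s 0 s_in z_in; rewrite scale0r addr0.
rewrite -![(_ - _ : _ -> _) _]/(_ - _) scale0r !addr0 (addrAC a) => E1.
have /(MVT_closed t0)[c' c'_in E2] : forall s, 0 <= s <= t -> is_derive s (1 : R)
    (fun s => 'D_v f (a + c *: v + s *: w))
    ('D_w ('D_v f) (a + c *: v + s *: w)).
  move=> s s_in; apply: is_derive_line; apply: dDf.
  by have [] := inB c s c_in s_in.
rewrite E1 (addrAC a).
move: E2; rewrite scale0r addr0 => ->.
have [_ B] := inB c c' c_in c'_in.
rewrite -mulrA -expr2 -mulrBl normrM distrC (ger0_norm (sqr_ge0 t)).
by rewrite ler_wpM2r ?sqr_ge0// ltW.
Qed.

Lemma derive_comm (U : set 'rV[R]_k) f a v w : open U -> U a ->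
  (forall u, U u -> differentiable f u) ->
  (forall u, U u -> differentiable ('D_v f) u) ->
  (forall u, U u -> differentiable ('D_w f) u) ->
  {for a, continuous ('D_w ('D_v f))} -> {for a, continuous ('D_v ('D_w f))} ->
  'D_w ('D_v f) a = 'D_v ('D_w f) a.
Proof.
move=> oU Ua df dv dw cvw cwv; apply/eqP; rewrite -subr_eq0 -normr_le0.
apply/ler_addgt0Pl => e e0; rewrite addr0.
have e2 : 0 < e / 2 by rewrite divr_gt0.
have [d d0 Hd] := second_difference oU Ua df dv cvw e2.
have [d' d'0 Hd'] := second_difference oU Ua df dw cwv e2.
(* The second difference is symmetric in [v] and [w], so at a common [t] both mixed derivatives,
   times [t ^+ 2], are within [e / 2 * t ^+ 2] of the same number. *)
pose t := Num.min d d' / 2.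
have t0 : 0 < t by rewrite divr_gt0// lt_min d0.
have tm : t < Num.min d d'.
  by rewrite ltr_pdivrMr// ltr_pMr ?ltr1n// lt_min d0.
move: tm; rewrite lt_min => /andP[td td'].
have := Hd t; rewrite t0 td => /(_ isT) H1.
have := Hd' t; rewrite t0 td' => /(_ isT) H2.
have t20 : 0 < t ^+ 2 by rewrite exprn_gt0.
rewrite -(ler_pM2r t20) -(ger0_norm (ltW t20)) -normrM (ger0_norm (ltW t20)).
move: H1 H2; rewrite (addrAC a (t *: w)).
set S1 := f _; set S2 := f _; set S3 := f _; set S4 := f _.
set D1 := 'D_w _ _; set D2 := 'D_v _ _ => H1 H2.
have -> : (D1 - D2) * t ^+ 2 = (S1 - S3 - (S2 - S4) - D2 * t ^+ 2) -
    (S1 - S2 - (S3 - S4) - D1 * t ^+ 2) by ring.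
apply: le_trans (ler_normB _ _) _.
have -> : e * t ^+ 2 = e / 2 * t ^+ 2 + e / 2 * t ^+ 2 by rewrite -mulrDl -splitr.
exact: lerD H2 H1.

Qed.

End Schwarz.

Lemma partial_comm (R : realType) (k N : nat) (V : set 'rV[R]_k)
    (f : 'rV[R]_k -> 'rV[R]_N) u i j :
  open V -> smooth_on V f -> V u ->
  partial i (partial j f) u = partial j (partial i f) u.
Proof.
move=> oV sf Vu; apply/rowP => l.
have Cf := (smooth_onP _ oV).1 sf.
have df := Cr_differentiable Cf.
have dp i' : forall x, V x -> differentiable (partial i' f) x.
  by apply: Cr_differentiable; apply/smooth_onP => //; exact: smooth_partial.
have Cl := (Cr_rowP 2 f oV).1 (Cf 2%N) l.
have pE i' j' : partial i' (partial j' f) u 0 l =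
    partialR i' (partialR j' (fun x => f x 0 l)) u.
  rewrite [LHS]derive_coord; last exact: dp.
  apply: near_eq_derive; apply: (open_near oV Vu) => x Vx.
  by rewrite [LHS]derive_coord//; exact: df.
apply: etrans (pE i j) (etrans _ (esym (pE j i))).
apply: (@derive_comm _ _ V _ _ (delta_mx 0 j) (delta_mx 0 i) oV Vu Cl.1).
- exact: (Cl.2 _).1.
- exact: (Cl.2 _).1.
- exact: ((Cl.2 _).2 _ _ Vu).
- exact: ((Cl.2 _).2 _ _ Vu).
Qed.

(** * Local parametrizations and tangent spaces *)

Lemma dotvE (R : realType) N (a b : 'rV[R]_N) : dotv a b = (a *m b^T) 0 0.
Proof. by rewrite mxE; apply: eq_bigr => j _; rewrite mxE. Qed.

Lemma dotv0P (R : realType) N (a : 'rV[R]_N) : a *m a^T = 0 -> a = 0.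
Proof.
move=> /matrixP/(_ 0 0); rewrite !mxE => /eqP; rewrite psumr_eq0 => [/allP H|j _].
  apply/rowP => j; rewrite mxE; have := H j (mem_index_enum _).
  by rewrite mxE mulf_eq0 orbb => /eqP.
by rewrite mxE -expr2 sqr_ge0.
Qed.

(** Positive definiteness: if [v] kills the Gram matrix then [v *m J] has norm zero, and the right
    inverse of [J] recovers [v = 0]. *)
Lemma gram_unitmx (R : realType) k N (J : 'M[R]_(k, N)) (B : 'M[R]_(N, k)) :
  J *m B = 1%:M -> J *m J^T \in unitmx.
Proof.
move=> JB; rewrite -row_free_unit -kermx_eq0; apply/rowV0P => v.
move=> /sub_kermxP vG; have vJ : v *m J = 0.
  by apply: dotv0P; rewrite trmx_mul mulmxA -(mulmxA v) vG mul0mx.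
by rewrite -[v]mulmx1 -JB mulmxA vJ mul0mx.
Qed.

Section LocalParam.
Variables (R : realType) (k N : nat).
Implicit Types (M : set 'rV[R]_N) (V : set 'rV[R]_k) (f : 'rV[R]_k -> 'rV[R]_N).

Lemma local_param_mem M V f u : local_param M V f -> V u -> M (f u).
Proof.
move=> [_ _ [W [g [_ E _ _]]]] Vu.
by have : (f @` V) (f u) by [exists u]; rewrite E => -[].
Qed.

Lemma local_param_differentiable M V f u :
  local_param M V f -> V u -> differentiable f u.
Proof.
by move=> [oV sf _] Vu; apply: (Cr_differentiable ((smooth_onP _ oV).1 sf)).
Qed.

(** The inverse chart is smooth only as a map on a subset of [M]. Here it is replaced, near [f u],
    by an extension to an open set of the ambient space, which can be differentiated. *)
Lemma local_param_inverse M V f u : local_param M V f -> V u ->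
  exists W G, [/\ open W, W (f u), forall r, Cr_on r W G,
    forall x, M x -> W x -> V (G x) /\ f (G x) = x &
    forall v, V v -> W (f v) -> G (f v) = v].
Proof.
move=> lp Vu; have Mfu := local_param_mem lp.
have [oV sf [W [g [oW E sg gK]]]] := lp.
have MW v : V v -> (M `&` W) (f v) by move=> Vv; rewrite -E; exists v.
have [W' [G [oW' W'fu CG Gg]]] := sg _ (MW u Vu).
exists (W `&` W'), G; split=> //.
- exact: openI.
- by split=> //; have [] := MW u Vu.
- by move=> r; apply: Cr_sub (CG r); move=> ? [].
- move=> x Mx [Wx W'x]; have : (f @` V) x by rewrite E.
  move=> [v Vv fv]; suff -> : G x = v by [].
  by rewrite Gg// -fv gK.
- by move=> v Vv [Wv W'v]; rewrite Gg ?gK//; exact: MW.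
Qed.

Lemma near_preimage M V f u (W : set 'rV[R]_N) : local_param M V f -> V u ->
  open W -> W (f u) -> open (V `&` f @^-1` W).
Proof.
move=> [oV sf _] Vu oW Wfu; apply: open_preimage_on => //.
exact: Cr_continuous ((smooth_onP _ oV).1 sf).
Qed.

(** Differentiate [G \o f = id] at [u], with [G] the extended inverse chart; its Jacobian is the
    right inverse. *)
Lemma jacobian_rinv M V f u : local_param M V f -> V u ->
  exists B, 'J f u *m B = 1%:M.
Proof.
move=> lp Vu; have [W [G [oW Wfu CG _ GK]]] := local_param_inverse lp Vu.
have df := local_param_differentiable lp Vu.
have dG := Cr_differentiable CG Wfu.
exists ('J G (f u)); apply/row_matrixP => i; rewrite !rowE mulmxA mulmx1.
rewrite -deriveEjacobian// -deriveEjacobian// deriveE// deriveE//.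
rewrite -[LHS]/(('d G (f u) \o 'd f u) _) -diff_comp// -deriveE; last first.
  exact: differentiable_comp.
rewrite -[RHS](@derive_id _ _ u); apply: near_eq_derive.
apply: (open_near (near_preimage lp Vu oW Wfu)) => // x [Vx Wx].
exact: GK.
Qed.

Lemma first_ff_unit M V f u : local_param M V f -> V u ->
  first_ff f u \in unitmx.
Proof. by move=> lp Vu; have [B /gram_unitmx] := jacobian_rinv lp Vu. Qed.

Lemma tangentP M V f u v : local_param M V f -> V u ->
  tangent k M (f u) v <-> exists w, v = w *m 'J f u.
Proof.
move=> lp Vu; have df := local_param_differentiable lp Vu.
split=> [[V' [f' [u' [w [lp' Vu' ff' ->]]]]]|[w ->]]; last first.
  by exists V, f, u, w; split=> //; rewrite -deriveE// deriveEjacobian.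
have [W [G [oW Wfu CG fG GK]]] := local_param_inverse lp Vu.
have df' := local_param_differentiable lp' Vu'.
have Wfu' : W (f' u') by rewrite ff'.
have dG : differentiable G (f' u') := Cr_differentiable CG Wfu'.
have Gfu : G (f' u') = u by rewrite ff' GK.
have dfG : differentiable f ((G \o f') u') by rewrite /= Gfu.
have dGf : differentiable (G \o f') u' by exact: differentiable_comp.
(* The transition map [G \o f'] carries the second chart to the first: [f' = f \o (G \o f')] near
   [u'], so the chain rule puts every tangent vector in the row space of ['J f u]. *)
exists ('d (G \o f') u' w); rewrite -(deriveEjacobian _ df).
transitivity ('D_w (f \o (G \o f')) u').
  rewrite -(deriveE _ df'); apply: near_eq_derive.
  apply: (open_near (near_preimage lp' Vu' oW Wfu')) => // x [Vx Wx] /=.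
  by have [_ ->] := fG _ (local_param_mem lp' Vx) Wx.
rewrite (deriveE _ (differentiable_comp dGf dfG)) (diff_comp dGf dfG).
by rewrite (deriveE _ df) /= Gfu.
Qed.

Lemma conormalP M V f u xi : local_param M V f -> V u ->
  conormal k M (f u) xi <-> xi *m ('J f u)^T = 0.
Proof.
move=> lp Vu; split=> [H|H v /(tangentP _ lp Vu)[w ->]]; last first.
  by rewrite dotvE trmx_mul mulmxA H mul0mx mxE.
apply/rowP => i; have := H (row i ('J f u)).
rewrite dotvE tr_row colE mulmxA -colE mxE => ->; first by rewrite mxE.
by apply/(tangentP _ lp Vu); exists (delta_mx 0 i); rewrite -rowE.
Qed.

(** Charts are later shrunk to the region where the adapted normal frame exists. *)
Lemma local_param_restrict M V V' f : local_param M V f -> open V' ->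
  V' `<=` V -> local_param M V' f.
Proof.
move=> lp oV' V'V; have [oV sf [W [g [oW E sg gK]]]] := lp.
(* The image of [V'] must be cut out of [M] by an open set of the ambient space. The largest open
   set on which [g] takes points of [M] in [W] into [V'] does so; local extensions of [g] show that
   it contains the image. *)
pose O := \bigcup_(X in [set X | open X /\
  forall x, M x -> W x -> X x -> V' (g x)]) X.
split=> //; first exact: smooth_on_sub sf.
have oO : open O by apply: bigcup_open => X [].
have MW v : V v -> (M `&` W) (f v) by move=> Vv; rewrite -E; exists v.
exists (W `&` O), g; split.
- exact: openI.
- apply/seteqP; split=> x.
    move=> [u V'u <-]; have [Mfu Wfu] := MW u (V'V u V'u).
    split=> //; split=> //.
    have [W' [G [oW' W'fu CG Gg]]] := sg _ (MW u (V'V u V'u)).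
    exists (W' `&` G @^-1` V'); last first.
      by split=> //=; rewrite Gg// gK//; exact: V'V.
    split; first by apply: open_preimage_on => //; exact: Cr_continuous.
    by move=> y My Wy [W'y /=]; rewrite Gg.
  move=> [Mx [Wx [X [oX XV'] Xx]]]; have : (f @` V) x by rewrite E.
  move=> [u Vu fu]; exists u => //; rewrite -(gK u Vu) fu; exact: XV'.
- by apply: smooth_on_sub sg => x [Mx []].
- by move=> u V'u; apply/gK/V'V.
Qed.

End LocalParam.

(** * Dot products and 2 x 2 matrices *)

Section Dot.
Variable R : realType.

Lemma dotvC N (a b : 'rV[R]_N) : dotv a b = dotv b a.
Proof. by apply: eq_bigr => j _; rewrite mulrC. Qed.

Lemma dotvDl N (a b c : 'rV[R]_N) : dotv (a + b) c = dotv a c + dotv b c.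
Proof. by rewrite !dotvE mulmxDl mxE. Qed.

Lemma dotvZl N s (a c : 'rV[R]_N) : dotv (s *: a) c = s * dotv a c.
Proof. by rewrite !dotvE -scalemxAl mxE. Qed.

Lemma dotvZr N s (a c : 'rV[R]_N) : dotv a (s *: c) = s * dotv a c.
Proof. by rewrite dotvC dotvZl dotvC. Qed.

Lemma dotvDr N (a b c : 'rV[R]_N) : dotv c (a + b) = dotv c a + dotv c b.
Proof. by rewrite dotvC dotvDl !(dotvC c). Qed.

Lemma dotv_sumr N (I : Type) (s : seq I) (P : pred I) (F : I -> 'rV[R]_N) c :
  dotv c (\sum_(i <- s | P i) F i) = \sum_(i <- s | P i) dotv c (F i).
Proof.
elim/big_rec2: _ => [|i x y _ <-]; last by rewrite dotvDr.
by rewrite dotvE trmx0 mulmx0 mxE.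
Qed.

Lemma dotv_ge0 N (a : 'rV[R]_N) : 0 <= dotv a a.
Proof. by apply: sumr_ge0 => j _; rewrite -expr2 sqr_ge0. Qed.

Lemma dotv_eq0 N (a : 'rV[R]_N) : dotv a a = 0 -> a = 0.
Proof.
move=> a0; apply: dotv0P; apply/matrixP => i j; rewrite !ord1 -dotvE a0.
by rewrite mxE.
Qed.

Lemma derivable_dotv (V : normedModType R) N (f g : V -> 'rV[R]_N) u v :
  differentiable f u -> differentiable g u ->
  is_derive u v (fun x => dotv (f x) (g x))
    (dotv ('D_v f u) (g u) + dotv (f u) ('D_v g u)).
Proof.
move=> df dg.
have fd j : derivable (fun x => f x 0 j) u v.
  by apply: (derivable_mxP f u v).1; exact: diff_derivable.
have gd j : derivable (fun x => g x 0 j) u v.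
  by apply: (derivable_mxP g u v).1; exact: diff_derivable.
have -> : (fun x => dotv (f x) (g x)) =
    \sum_(j < N) ((fun x => f x 0 j) * (fun x => g x 0 j)).
  by apply/funext => x; rewrite fct_sumE.
rewrite /dotv -big_split /=.
apply: is_derive_sum => j.
apply: is_derive_eq; first by apply: is_deriveM; apply: derivableP.
have vf : derivable f u v by exact: diff_derivable.
have vg : derivable g u v by exact: diff_derivable.
rewrite (derive_mx vf) (derive_mx vg) !mxE /GRing.scale /=.
by rewrite [LHS]addrC; congr (_ + _); exact: mulrC.
Qed.

Lemma derive_div_sqrt (V : normedModType R) (n d : V -> R) u v :
  derivable n u v -> differentiable d u -> 0 < d u ->
  'D_v (fun x => n x / Num.sqrt (d x)) u =
  'D_v n u / Num.sqrt (d u) - n u * 'D_v d u / (2 * Num.sqrt (d u) * d u).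
Proof.
move=> dn dd d0.
have s0 : Num.sqrt (d u) != 0 by rewrite gt_eqF// sqrtr_gt0.
have ds : differentiable Num.sqrt (d u).
  by apply/derivable1_diffP; have [] := is_derive1_sqrt d0.
have dsd : differentiable (Num.sqrt \o d) u by exact: differentiable_comp.
have E : 'D_v (Num.sqrt \o d) u = 'D_v d u / (2 * Num.sqrt (d u)).
  rewrite deriveE// diff_comp//= deriv1E; last exact/derivable1_diffP.
  by rewrite derive1E derive_sqrt// (deriveE _ dd).
have s2 : d u = Num.sqrt (d u) ^+ 2 by rewrite sqr_sqrtr// ltW.
have dv : derivable (Num.sqrt \o d) u v := diff_derivable dsd.
pose g : V -> R := fun x => ((Num.sqrt \o d) x)^-1.
have dg : derivable g u v by exact: (@derivableV _ _ (Num.sqrt \o d) u v s0 dv).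
have -> : (fun x => n x / Num.sqrt (d x)) = n * g by [].
rewrite (@deriveM _ _ n g u v dn dg).
rewrite (@deriveV _ _ (Num.sqrt \o d) u v s0 dv) E /g /GRing.scale /=.
rewrite [X in _ = _ - _ / (_ * X)]s2.
by set s := Num.sqrt (d u) in s0 *; field.
Qed.

Lemma ord2_sum (W : nmodType) (F : 'I_2 -> W) : \sum_i F i = F 0 + F 1.
Proof. by rewrite big_ord_recl big_ord1; congr (_ + F _); exact/val_inj. Qed.

Lemma det22 (S : comNzRingType) (A : 'M[S]_2) : \det A = A 0 0 * A 1 1 - A 0 1 * A 1 0.
Proof.
rewrite (expand_det_row _ 0) ord2_sum /cofactor !det_mx11 !mxE /= addn0 expr0.
by rewrite mul1r add0n expr1 mulN1r mulrN; congr (_ * A _ _ - _ * A _ _); exact/val_inj.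
Qed.

Lemma invmx22 (A : 'M[R]_2) : A \in unitmx ->
  [/\ invmx A 0 0 = A 1 1 / \det A, invmx A 0 1 = - A 0 1 / \det A,
      invmx A 1 0 = - A 1 0 / \det A & invmx A 1 1 = A 0 0 / \det A].
Proof.
move=> uA; rewrite /invmx uA !mxE /cofactor !det_mx11 !mxE /=.
have e0 : lift (0 : 'I_2) 0 = 1 by exact/val_inj.
have e1 : lift (1 : 'I_2) 0 = 0 by exact/val_inj.
rewrite !e0 !e1 !addn0 !add0n expr0 expr1 addnn -signr_odd expr0.
by rewrite !mul1r !mulN1r ![_^-1 * _]mulrC.
Qed.

End Dot.

(** * Surfaces *)

Section FirstFF.
Variables (R : realType) (k N : nat).
Implicit Types (M : set 'rV[R]_N) (V : set 'rV[R]_k) (f : 'rV[R]_k -> 'rV[R]_N).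

Lemma smoothR_differentiable V (a : 'rV[R]_k -> R) u :
  open V -> smoothR_on V a -> V u -> differentiable a u.
Proof.
move=> oV sa Vu; have [W [F [oW Wu CF Fa]]] := sa u Vu.
apply: near_eq_differentiable ((CF 1%N).1 u Wu).
by apply: (open_near (openI oV oW)) => // x [Vx Wx]; exact: Fa.
Qed.

Lemma smoothR_dotv V (f g : 'rV[R]_k -> 'rV[R]_N) :
  smooth_on V f -> smooth_on V g -> smoothR_on V (fun x => dotv (f x) (g x)).
Proof.
move=> /smooth_rowP sf /smooth_rowP sg.
by apply: smoothR_sum => j _; exact: smoothRM.
Qed.

Lemma smooth_differentiable V f u :
  open V -> smooth_on V f -> V u -> differentiable f u.
Proof. by move=> oV /(smooth_onP _ oV) Cf; exact: Cr_differentiable. Qed.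

Lemma first_ffE f u i j : differentiable f u ->
  first_ff f u i j = dotv (partial i f u) (partial j f u).
Proof.
by move=> df; rewrite mxE; apply: eq_bigr => l _; rewrite -!row_jacobian// !mxE.
Qed.

Lemma first_ff_sym f u : (first_ff f u)^T = first_ff f u.
Proof. by rewrite trmx_mul trmxK. Qed.

Lemma normal_projT f u : (normal_proj f u)^T = normal_proj f u.
Proof.
rewrite /normal_proj linearB /= trmx1 !trmx_mul trmxK trmx_inv first_ff_sym.
by rewrite mulmxA.
Qed.

Lemma normal_proj_jacobian f u : first_ff f u \in unitmx ->
  normal_proj f u *m ('J f u)^T = 0.
Proof.
move=> uG; rewrite mulmxBl mul1mx -!mulmxA -/(first_ff f u) mulVmx//.
by rewrite mulmx1 subrr.
Qed.

Lemma normal_proj_id f u (xi : 'rV[R]_N) : xi *m ('J f u)^T = 0 ->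
  xi *m normal_proj f u = xi.
Proof. by move=> xJ; rewrite mulmxBr mulmx1 !mulmxA xJ !mul0mx subr0. Qed.

(** The normal component of [mu] is itself conormal, so [mu] vanishes on it; as the projection is
    symmetric and idempotent, that value is the squared norm of the component. *)
Lemma one_form_tangential M V f u mu : local_param M V f -> V u ->
  one_form k M mu ->
  mu (f u) = mu (f u) *m ('J f u)^T *m invmx (first_ff f u) *m 'J f u.
Proof.
move=> lp Vu [_ muT]; have uG := first_ff_unit lp Vu.
set P := normal_proj f u.
have PP : P *m P = P.
  rewrite {2}/P /normal_proj mulmxBr mulmx1 !mulmxA normal_proj_jacobian//.
  by rewrite !mul0mx subr0.
have muP : mu (f u) *m P = 0.
  apply: dotv0P; rewrite trmx_mul normal_projT mulmxA -(mulmxA _ P) PP.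
  have cn : conormal k M (f u) (mu (f u) *m P).
    by apply/(conormalP _ lp Vu); rewrite -mulmxA normal_proj_jacobian// mulmx0.
  have := muT _ (local_param_mem lp Vu) _ cn.
  rewrite dotvC dotvE => E; apply/matrixP => i j.
  by rewrite !ord1 E mxE.
apply/eqP; rewrite -subr_eq0 -!mulmxA -{1}[mu (f u)]mulmx1 -mulmxBr.
by rewrite !mulmxA -/P muP.
Qed.

End FirstFF.

(* [E F K] are the coefficients of the metric, [p q] those of the 1-form,
   [x_ij] and [y_ij] the products of the second derivatives with the two
   tangent vectors, [m] the pairing of the 1-form with a second derivative; the
   hypothesis is coclosedness with the quotients by [s = sqrt D] differentiated. *)
Lemma codifferential_identity (L : numFieldType)
    (E F K s p q p0 p1 q0 q1 x00 x01 x11 y00 y01 y11 : L) (D := E * K - F * F) :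
  s != 0 -> D != 0 ->
  let E0 := x00 + x00 in let E1 := x01 + x01 in
  let F0 := y00 + x01 in let F1 := y01 + x11 in
  let K0 := y01 + y01 in let K1 := y11 + y11 in
  let D0 := E0 * K + E * K0 - (F0 * F + F * F0) in
  let D1 := E1 * K + E * K1 - (F1 * F + F * F1) in
  let m x y := (p * (K / D) * x + p * (- F / D) * y) +
               (q * (- F / D) * x + q * (E / D) * y) in
  ((K0 * p + K * p0 - (F0 * q + F * q0)) / s -
     (K * p - F * q) * D0 / (2 * s * D)) +
  ((E1 * q + E * q1 - (F1 * p + F * p1)) / s -
     (E * q - F * p) * D1 / (2 * s * D)) = 0 ->
  (K / D * (p0 - m x00 y00) + - F / D * (q0 - m x01 y01)) +
  (- F / D * (p1 - m x01 y01) + E / D * (q1 - m x11 y11)) = 0.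
Proof.
move=> s0 D0 /= H.
(* The left side of the hypothesis is [D / s] times the left side of the goal, so the goal is
   multiplied by this nonzero factor before [field] compares the two. *)
apply: (mulIf (invr_neq0 s0)); rewrite mul0r.
apply: (mulfI D0); rewrite mulr0 -{}H.
rewrite {}/D in D0 *; field.
by rewrite s0 D0 ?pnatr_eq0.
Qed.

Lemma is_derive_mulB (R : realType) (W : normedModType R)
    (a b c e : W -> R) (u v : W) a' b' c' e' :
  is_derive u v a a' -> is_derive u v b b' -> is_derive u v c c' ->
  is_derive u v e e' ->
  is_derive u v (a * b - c * e) (a' * b u + a u * b' - (c' * e u + c u * e')).
Proof.
move=> da db dc de.
apply: is_derive_eq (is_deriveB (is_deriveM da db) (is_deriveM dc de)) _.
rewrite /GRing.scale /=; congr (_ - _).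
  by rewrite [LHS]addrC [X in X + _ = _]mulrC.
by rewrite [LHS]addrC [X in X + _ = _]mulrC.
Qed.

Lemma derive_flux (R : realType) (W : normedModType R) (n d : W -> R)
    (u v : W) n' d' :
  is_derive u v n n' -> is_derive u v d d' -> differentiable d u -> 0 < d u ->
  'D_v (fun x => n x / Num.sqrt (d x)) u =
  n' / Num.sqrt (d u) - n u * d' / (2 * Num.sqrt (d u) * d u).
Proof. by move=> [dn <-] [_ <-]; exact: derive_div_sqrt. Qed.

(** * Harmonic forms and the Hessian-type matrix on a minimal surface *)

Section Surface.
Variables (R : realType) (N : nat) (M : set 'rV[R]_N).
Variables (mu : 'rV[R]_N -> 'rV[R]_N) (V : set 'rV[R]_2).
Variables (f : 'rV[R]_2 -> 'rV[R]_N) (u : 'rV[R]_2).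
Hypotheses (minM : minimal 2 M) (harm : harmonic_form 2 M mu).
Hypotheses (lp : local_param M V f) (Vu : V u).

Let oV : open V. Proof. by case: lp. Qed.
Let sf : smooth_on V f. Proof. by case: lp. Qed.
Let df x : V x -> differentiable f x.
Proof. exact: local_param_differentiable lp. Qed.
Let dpf i x : V x -> differentiable (partial i f) x.
Proof. by move=> Vx; apply: smooth_differentiable Vx => //; exact: smooth_partial. Qed.

Lemma smooth_pullback : smooth_on V (mu \o f).
Proof.
have [[smu _] _ _] := harm.
by apply: (smooth_on_comp _ sf smu) => x Vx; exact: local_param_mem lp Vx.
Qed.

(** The determinant is nonzero because the chart is an immersion, and nonnegative by Cauchy-Schwarz
    in the exact form [|a|^2 (|a|^2 |b|^2 - (a.b)^2) = | |a|^2 b - (a.b) a |^2]. *)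
Lemma gram_det_gt0 x : V x -> 0 < \det (first_ff f x).
Proof.
move=> Vx; have := first_ff_unit lp Vx; rewrite unitmxE unitfE => D0.
rewrite lt_def D0 /=; move: D0.
rewrite det22 !first_ffE; try exact: df.
move: (partial 0 f x) (partial 1 f x) => a b D0.
have [a0|a0] := eqVneq (dotv a a) 0.
  have z0 : dotv (0 : 'rV[R]_N) b = 0 by rewrite dotvE mul0mx mxE.
  by move: D0; rewrite a0 (dotv_eq0 a0) z0 !mul0r subrr eqxx.
have a_gt0 : 0 < dotv a a by rewrite lt_def a0 dotv_ge0.
rewrite -(pmulr_rge0 _ a_gt0).
suff -> : dotv a a * (dotv a a * dotv b b - dotv a b * dotv b a) =
    dotv (dotv a a *: b + - dotv a b *: a) (dotv a a *: b + - dotv a b *: a).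
  exact: dotv_ge0.
rewrite !(dotvDl, dotvDr, dotvZl, dotvZr) (dotvC b a); ring.
Qed.

Lemma derive_first_ff (v : 'rV[R]_2) i j :
  is_derive u v (fun x => first_ff f x i j)
    (dotv ('D_v (partial i f) u) (partial j f u) +
     dotv (partial i f u) ('D_v (partial j f) u)).
Proof.
apply: (@near_eq_is_derive _ _ _ (fun x => dotv (partial i f x) (partial j f x))).
  by apply: (open_near oV Vu) => x Vx; rewrite first_ffE//; exact: df.
by apply: derivable_dotv; exact: dpf.
Qed.

Lemma derive_coef (v : 'rV[R]_2) i :
  is_derive u v (coef f mu i) ('D_v (coef f mu i) u).
Proof.
apply: derivableP; apply: diff_derivable.
apply: (smoothR_differentiable oV _ Vu).
exact: smoothR_dotv smooth_pullback (smooth_partial _ oV sf).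
Qed.

(** With [v] a second derivative of [f], the right side is the Christoffel term of the covariant
    derivative of [mu]. *)
Lemma dotv_tangential v : dotv (mu (f u)) v =
  \sum_k \sum_l coef f mu k u * invmx (first_ff f u) k l * dotv v (partial l f u).
Proof.
have [om _ _] := harm.
rewrite (one_form_tangential lp Vu om) dotvE -!mulmxA mulmxA mxE.
apply: eq_bigr => k _.
rewrite [X in _ * X]mxE mulr_sumr; apply: eq_bigr => l _.
rewrite mulrA; congr (_ * _ * _).
  by rewrite mxE; apply: eq_bigr => j _; rewrite !mxE -row_jacobian ?mxE//; exact: df.
by rewrite dotvC mxE; apply: eq_bigr => j _; rewrite -row_jacobian ?mxE//; exact: df.
Qed.

Let c j x := coef f mu j x.
Let g i j x := first_ff f x i j.
Let d i j := partial i (partial j f) u.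

(** The bracket is the covariant derivative of [mu], so this is coclosedness written as a vanishing
    metric trace. Derivatives of the metric and Christoffel terms are both expressed by products of
    second derivatives with tangent vectors, after which the comparison is purely algebraic. *)
Lemma coclosed_trace :
  \sum_i \sum_j invmx (first_ff f u) i j *
    (partialR i (coef f mu j) u - dotv (mu (f u)) (d i j)) = 0.
Proof.
have [_ _ cocl] := harm.
have uG x : V x -> first_ff f x \in unitmx by exact: first_ff_unit lp.
have D0 := gram_det_gt0 Vu.
have gS : g 1 0 = g 0 1.
  by apply/funext => x; rewrite /g -[in LHS]first_ff_sym mxE.
have gS' x : first_ff f x 1 0 = first_ff f x 0 1 := congr1 (fun h => h x) gS.
pose D : 'rV[R]_2 -> R := g 0 0 * g 1 1 - g 0 1 * g 0 1.
have DE x : \det (first_ff f x) = D x by rewrite det22 gS'.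
(* Numerators of the raised components of [mu]: by Cramer's rule these components are [n0 / D] and
   [n1 / D], and the factor [sqrt D] of the codifferential leaves [n0 / sqrt D] and [n1 / sqrt D] to
   differentiate. *)
pose n0 : 'rV[R]_2 -> R := g 1 1 * c 0 - g 0 1 * c 1.
pose n1 : 'rV[R]_2 -> R := g 0 0 * c 1 - g 0 1 * c 0.
have fluxE i (n : 'rV[R]_2 -> R) : (forall x, V x ->
     \sum_j invmx (first_ff f x) i j * coef f mu j x = n x / D x) ->
    partialR i (fun x => Num.sqrt (\det (first_ff f x)) *
      \sum_j invmx (first_ff f x) i j * coef f mu j x) u =
    partialR i (fun x => n x / Num.sqrt (D x)) u.
  move=> nE; apply: near_eq_derive; apply: (open_near oV Vu) => x Vx.
  rewrite nE// DE; have := gram_det_gt0 Vx; rewrite DE => Dx.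
  have s0 : Num.sqrt (D x) != 0 by rewrite gt_eqF// sqrtr_gt0.
  rewrite -[in X in _ * (_ / X)](sqr_sqrtr (ltW Dx)) mulrCA; congr (_ * _).
  by rewrite expr2 invfM mulrA mulfV// mul1r.
have n0E x : V x -> \sum_j invmx (first_ff f x) 0 j * coef f mu j x = n0 x / D x.
  move=> Vx; rewrite ord2_sum; have [-> -> _ _] := invmx22 (uG x Vx).
  by rewrite DE mulrAC [X in _ + X]mulrAC -mulrDl mulNr.
have n1E x : V x -> \sum_j invmx (first_ff f x) 1 j * coef f mu j x = n1 x / D x.
  move=> Vx; rewrite ord2_sum; have [_ _ -> ->] := invmx22 (uG x Vx).
  by rewrite DE gS' mulrAC [X in _ + X]mulrAC -mulrDl mulNr addrC.
pose x_ i j := dotv (d i j) (partial 0 f u).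
pose y_ i j := dotv (d i j) (partial 1 f u).
have dC : d 1 0 = d 0 1 by exact: partial_comm Vu.
have dg i : [/\ is_derive u (delta_mx 0 i) (g 0 0) (x_ i 0 + x_ i 0),
    is_derive u (delta_mx 0 i) (g 0 1) (y_ i 0 + x_ i 1) &
    is_derive u (delta_mx 0 i) (g 1 1) (y_ i 1 + y_ i 1)].
  split.
  - exact: (is_derive_eq (derive_first_ff _ 0 0)
      (congr2 +%R (erefl _) (dotvC (partial 0 f u) (d i 0)))).
  - exact: (is_derive_eq (derive_first_ff _ 0 1)
      (congr2 +%R (erefl _) (dotvC (partial 0 f u) (d i 1)))).
  - exact: (is_derive_eq (derive_first_ff _ 1 1)
      (congr2 +%R (erefl _) (dotvC (partial 1 f u) (d i 1)))).
pose dc i j := partialR i (c j) u.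
have dcE i j : is_derive u (delta_mx 0 i) (c j) (dc i j) by exact: derive_coef.
have dD : differentiable D u.
  have sg i j : smoothR_on V (g i j).
    apply: (@smoothR_ext _ _ _ (fun x => dotv (partial i f x) (partial j f x))).
      by move=> x Vx; rewrite -(first_ffE i j (df Vx)).
    by apply: smoothR_dotv; exact: smooth_partial.
  apply: (smoothR_differentiable oV _ Vu); apply: smoothRD; first exact: smoothRM.
  by apply: smoothRN; exact: smoothRM.
have Du : 0 < D u by rewrite -DE; exact: gram_det_gt0.
have s0 : Num.sqrt (D u) != 0.
  by apply: lt0r_neq0; rewrite sqrtr_gt0; exact: Du.
have T v : dotv (mu (f u)) v =
    \sum_k \sum_l c k u * invmx (first_ff f u) k l * dotv v (partial l f u).
  exact: dotv_tangential.
have [g00 g01 g11] := dg 0; have [h00 h01 h11] := dg 1.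
have flux0 := derive_flux (is_derive_mulB g11 (dcE 0 0) g01 (dcE 0 1))
  (is_derive_mulB g00 g11 g01 g01) dD Du.
have flux1 := derive_flux (is_derive_mulB h00 (dcE 1 1) h01 (dcE 1 0))
  (is_derive_mulB h00 h11 h01 h01) dD Du.
have H := etrans (esym (congr2 +%R (etrans (fluxE _ _ n0E) flux0)
  (etrans (fluxE _ _ n1E) flux1))) (etrans (esym (ord2_sum _)) (cocl V f lp u Vu)).
have x10 : x_ 1 0 = x_ 0 1 := congr1 (fun w => dotv w (partial 0 f u)) dC.
have y10 : y_ 1 0 = y_ 0 1 := congr1 (fun w => dotv w (partial 1 f u)) dC.
transitivity (\sum_i \sum_j invmx (first_ff f u) i j * (dc i j -
    \sum_k (c k u * invmx (first_ff f u) k 0 * x_ i j +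
             c k u * invmx (first_ff f u) k 1 * y_ i j))).
  apply: eq_bigr => i _; apply: eq_bigr => j _; congr (_ * (_ - _)).
  by apply: etrans (T _) _; apply: eq_bigr => k _; exact: ord2_sum.
move: x_ y_ x10 y10 H {dg g00 g01 g11 h00 h01 h11 flux0 flux1} => x_ y_ x10 y10.
rewrite x10 y10 => H.
rewrite ord2_sum (ord2_sum (fun j => _ 0 j * _)) (ord2_sum (fun j => _ 1 j * _)).
rewrite !(ord2_sum (fun k => c k u * _ * _ + _)) x10 y10.
have [-> -> -> ->] := invmx22 (uG u Vu); rewrite gS' DE.
exact: (codifferential_identity s0 (lt0r_neq0 Du) H).
Qed.

Lemma hessian_symmetric xi i j :
  partialR i (coef f mu j) u - dotv xi (d i j) =
  partialR j (coef f mu i) u - dotv xi (d j i).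
Proof.
have [_ cl _] := harm.
exact: (congr2 (fun a b => a - dotv xi b) (cl V f lp u Vu i j)
  (partial_comm i j oV sf Vu)).
Qed.

Lemma hessian_traceless xi : xi *m ('J f u)^T = 0 ->
  \sum_i \sum_j invmx (first_ff f u) i j *
    (partialR i (coef f mu j) u - dotv (xi + mu (f u)) (d i j)) = 0.
Proof.
move=> xiJ; have H0 : dotv xi (mean_curvature f u) = 0.
  have [_ mc] := minM; rewrite (mc V f lp u Vu).
  by rewrite dotvE trmx0 mulmx0 mxE.
apply: etrans (_ : _ = (\sum_i \sum_j invmx (first_ff f u) i j *
    (partialR i (coef f mu j) u - dotv (mu (f u)) (d i j))) -
    dotv xi (mean_curvature f u)) _; last by rewrite coclosed_trace H0 subr0.
rewrite dotv_sumr -sumrB; apply: eq_bigr => i _.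
rewrite dotv_sumr -sumrB; apply: eq_bigr => j _.
(* The normal projection is symmetric and fixes the normal vector [xi], so pairing [xi] with the
   second fundamental form is pairing it with the plain second derivative. *)
have -> : dotv xi (invmx (first_ff f u) i j *: second_ff f u i j) =
    invmx (first_ff f u) i j * dotv xi (d i j).
  rewrite dotvZr; congr (_ * _).
  by rewrite /second_ff !dotvE trmx_mul normal_projT mulmxA normal_proj_id.
rewrite -mulrBr dotvDl; congr (_ * _).
by rewrite opprD [- _ - _]addrC addrA.
Qed.

End Surface.

(** * The holomorphic volume of a tangent frame *)

Section Phase.
Import complex.
Variable R : realType.
Local Notation rc := (real_complex R).
Local Notation ii := (Complex (0 : R) 1).

Lemma ImM_real (z : R[i]) (x : R) : complex.Im (rc x * z) = x * complex.Im z.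
Proof. by case: z => a b /=; rewrite mul0r addr0. Qed.

Lemma expiD (s t : R) : expi (s + t) = expi s * expi t.
Proof.
rewrite /expi cosD sinD; apply/eqP; rewrite eq_complex; apply/andP.
by split; apply/eqP => //=; exact: addrC.
Qed.

Lemma expi_pihalf k : expi (k%:R * (pi / 2)) = ii ^+ k :> R[i].
Proof.
elim: k => [|k IH]; first by rewrite mul0r /expi cos0 sin0.
rewrite exprSr -IH -addn1 natrD mulrDl mul1r expiD; congr (_ * _).
by rewrite /expi cos_pihalf sin_pihalf.
Qed.

Lemma expi_tan (phi : R) : cos phi != 0 ->
  expi phi * Complex 1 (- tan phi) = rc (cos phi)^-1.
Proof.
move=> c0; apply/eqP; rewrite eq_complex /= /tan.
have cs := cos2Dsin2 phi.
apply/andP; split; apply/eqP.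
  apply: (mulIf c0); rewrite mulVf// -[RHS]cs; field; exact: c0.
by field.
Qed.

Lemma Im_det22 (G H : 'M[R]_2) :
  complex.Im (\det (map_mx rc G + ii *: map_mx rc H)) =
  G 0 0 * H 1 1 + H 0 0 * G 1 1 - (G 0 1 * H 1 0 + H 0 1 * G 1 0).
Proof.
rewrite det22 !mxE /=.
move: (G 0 0) (G 0 1) (G 1 0) (G 1 1) (H 0 0) (H 0 1) (H 1 0) (H 1 1).
by move=> a b c d a' b' c' d'; ring.
Qed.

(** For matrices of size 2 the imaginary part is exactly [det G] times the trace of
    [invmx G *m H]. *)
Lemma Im_det_traceless (G H : 'M[R]_2) : G \in unitmx ->
  \sum_i \sum_j invmx G i j * H j i = 0 ->
  complex.Im (\det (map_mx rc G + ii *: map_mx rc H)) = 0.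
Proof.
move=> uG; have [G00 G01 G10 G11] := invmx22 uG.
have D0 : \det G != 0 by move: uG; rewrite unitmxE unitfE.
rewrite !ord2_sum G00 G01 G10 G11 Im_det22 => trH.
apply: (mulIf (invr_neq0 D0)); rewrite mul0r -{}trH.
move: (G 0 0) (G 0 1) (G 1 0) (G 1 1) (H 0 0) (H 0 1) (H 1 0) (H 1 1) D0.
by move: (\det G) => d a b c e a' b' c' d' D0; field.
Qed.

Variable n' : nat.
Local Notation n := (2 + n')%N.
Variables (J D : 'M[R]_(2, n)) (Nu : 'M[R]_(n', n)) (K0 : 'M[R]_(n, n')).
Hypotheses (NuJ : Nu *m J^T = 0) (NuK : Nu *m K0 = 1%:M).
Hypothesis uG : J *m J^T \in unitmx.
Hypothesis symH : (D *m J^T)^T = D *m J^T.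
Hypothesis trH : \sum_i \sum_j invmx (J *m J^T) i j * (D *m J^T) i j = 0.

(** Together with [frame_y], the real and imaginary parts of a tangent frame of the twisted conormal
    bundle: two rows along the surface, [n'] along the conormal fibre, whose real part is 0, and one
    along the line. *)
Definition frame_x : 'M[R]_(n + 1) := block_mx (col_mx J 0) 0 0 1%:M.
Definition frame_y (a : R) : 'M[R]_(n + 1) := block_mx (col_mx D Nu) 0 0 a%:M.

Lemma mul_frame_x p (v1 : 'M[R]_(p, 2)) (v2 : 'M[R]_(p, n')) v3 :
  row_mx (row_mx v1 v2) v3 *m frame_x = row_mx (v1 *m J) v3.
Proof.
by rewrite mul_row_block mul_row_col !mulmx0 mulmx1 !addr0 add0r.
Qed.

Lemma mul_frame_y a p (v1 : 'M[R]_(p, 2)) (v2 : 'M[R]_(p, n')) v3 :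
  row_mx (row_mx v1 v2) v3 *m frame_y a =
  row_mx (v1 *m D + v2 *m Nu) (v3 *m a%:M).
Proof. by rewrite mul_row_block mul_row_col !mulmx0 addr0 add0r. Qed.

(** Symmetry of this product says that the frame spans a Lagrangian subspace. The mixed block
    [J *m Nu^T] vanishes, leaving [D *m J^T], symmetric by hypothesis, and the scalar [a]. *)
Lemma frame_lagrangian a : (frame_x *m (frame_y a)^T)^T = frame_x *m (frame_y a)^T.
Proof.
have E : frame_x *m (frame_y a)^T =
    block_mx (block_mx ((D *m J^T)^T) 0 0 0) 0 0 a%:M.
  rewrite /frame_x /frame_y tr_block_mx mulmx_block !trmx0 !mulmx0 !mul0mx.
  rewrite !addr0 !add0r mul1mx tr_scalar_mx tr_col_mx mul_col_row !mul0mx.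
  have -> : J *m Nu^T = 0 by rewrite -[J]trmxK -trmx_mul NuJ trmx0.
  by rewrite trmx_mul trmxK.
by rewrite E !tr_block_mx !trmx0 tr_scalar_mx trmxK symH.
Qed.

(** Multiplying the surface block on the right by [row_mx J^T K0] makes it block triangular: [Nu]
    kills [J^T] and sends [K0] to the identity. The diagonal blocks are [G + i H] and [i] times the
    identity of size [n']. *)
Lemma det_frame (a : R) :
  \det (map_mx rc frame_x + ii *: map_mx rc (frame_y a)) *
    rc (\det (row_mx J^T K0)) =
  \det (map_mx rc (J *m J^T) + ii *: map_mx rc (D *m J^T)) * ii ^+ n' *
    Complex 1 a.
Proof.
have -> : map_mx rc frame_x + ii *: map_mx rc (frame_y a) =
    block_mx (col_mx (map_mx rc J + ii *: map_mx rc D) (ii *: map_mx rc Nu))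
      0 0 (Complex 1 a)%:M.
  rewrite !map_block_mx !map_col_mx !map_mx0 scale_block_mx add_block_mx.
  rewrite !scaler0 !addr0 scale_col_mx add_col_mx add0r; congr block_mx.
  rewrite !map_scalar_mx /= scale_scalar_mx -raddfD /=; congr _%:M.
  by apply/eqP; rewrite eq_complex /= !(mul0r, mul1r, add0r, subrr, subr0, addr0) !eqxx.
rewrite det_ublock det_scalar1 mulrAC; congr (_ * _).
rewrite -det_map_mx -det_mulmx map_row_mx mul_col_row.
rewrite -!scalemxAl -!map_mxM NuJ NuK map_mx0 scaler0 map_mx1.
rewrite det_ublock scalemx1 det_scalar; congr (\det _ * _).
by rewrite mulmxDl -scalemxAl -!map_mxM.
Qed.

(** The same triangular reduction, applied to the real matrix [col_mx J Nu], leaves the determinant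
    of the metric. *)
Lemma det_coframe_neq0 : \det (row_mx J^T K0) != 0.
Proof.
have : \det (col_mx J Nu *m row_mx J^T K0) != 0.
  rewrite mul_col_row NuJ NuK det_ublock det1 mulr1.
  by move: uG; rewrite unitmxE unitfE.
by rewrite det_mulmx mulf_eq0 negb_or => /andP[].
Qed.

Lemma frame_phase (phi : R) : cos phi != 0 ->
  complex.Im (expi (phi + (n%:R - 2) * (pi / 2)) *
    \det (map_mx rc frame_x + ii *: map_mx rc (frame_y (- tan phi)))) = 0.
Proof.
move=> c0; have T0 := det_coframe_neq0.
set d := \det (_ + _).
have -> : d = rc (\det (row_mx J^T K0))^-1 *
    (\det (map_mx rc (J *m J^T) + ii *: map_mx rc (D *m J^T)) * ii ^+ n' *
    Complex 1 (- tan phi)).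
  rewrite -det_frame mulrCA -rmorphM /= mulVf// [rc _]/(1 : R[i]) mulr1 //.
have -> : (n%:R - 2 : R) = n'%:R by rewrite natrD addrC addKr.
rewrite expiD expi_pihalf.
set z := \det (_ + _).
have -> : expi phi * ii ^+ n' * (rc (\det (row_mx J^T K0))^-1 *
    (z * ii ^+ n' * Complex 1 (- tan phi))) =
    rc (\det (row_mx J^T K0))^-1 * ((expi phi * Complex 1 (- tan phi)) *
      ((ii ^+ 2) ^+ n' * z)).
  by rewrite -exprM mulnC exprM expr2; ring.
rewrite expi_tan// sqr_i ImM_real.
have -> : (-1 : R[i]) ^+ n' = rc ((-1) ^+ n') by rewrite rmorphXn rmorphN rmorph1.
rewrite !ImM_real Im_det_traceless// ?mulr0//.
rewrite -[RHS]trH; apply: eq_bigr => i _; apply: eq_bigr => j _.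
by rewrite -[in LHS]symH mxE.
Qed.

End Phase.

(** * Cylinders *)

Section DirectionalDerivatives.
Variable R : realType.

(** A directional derivative sees only the restriction to one line, so maps on different spaces can
    be compared without a chain rule. *)
Lemma derive_along (k l N : nat) (F : 'rV[R]_k -> 'rV[R]_N)
    (G : 'rV[R]_l -> 'rV[R]_N) w v w' v' :
  (forall h : R, F (h *: v + w) = G (h *: v' + w')) -> 'D_v F w = 'D_v' G w'.
Proof.
move=> FG; have FG0 : F w = G w' by have := FG 0; rewrite !scale0r !add0r.
rewrite /derive.
have -> // : (fun h => h^-1 *: ((F \o shift w) (h *: v) - F w)) =
  (fun h => h^-1 *: ((G \o shift w') (h *: v') - G w')).
by apply/funext => h; rewrite /= FG FG0.
Qed.

Lemma derive_linear_comp (k l N : nat) (L : 'rV[R]_k -> 'rV[R]_l)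
    (F : 'rV[R]_l -> 'rV[R]_N) w v :
  (forall h : R, L (h *: v + w) = h *: L v + L w) ->
  'D_v (F \o L) w = 'D_(L v) F (L w).
Proof. by move=> linL; apply: derive_along => h /=; rewrite linL. Qed.

Lemma derive_affine (k N : nat) (A : 'M[R]_(k, N)) c s v :
  'D_v (fun y : 'rV[R]_k => y *m A + c) s = v *m A.
Proof.
apply/lim_near_cst => //=; near=> h.
rewrite opprD addrACA subrr addr0 mulmxDl addrK -scalemxAl scalerA mulVf ?scale1r//.
by near: h; exact: nbhs_dnbhs_neq.
Unshelve. all: by end_near. Qed.

Lemma differentiable_row_mx (k N M : nat) (F : 'rV[R]_k -> 'rV[R]_N)
    (G : 'rV[R]_k -> 'rV[R]_M) w :
  differentiable (fun x => row_mx (F x) (G x)) w <->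
  differentiable F w /\ differentiable G w.
Proof.
split=> [dFG|[dF dG]].
  split; apply/differentiable_rowP => i.
    have := (differentiable_rowP _ w).1 dFG (lshift _ i).
    by congr (differentiable _ _); apply/funext => x; rewrite row_mxEl.
  have := (differentiable_rowP _ w).1 dFG (rshift _ i).
  by congr (differentiable _ _); apply/funext => x; rewrite row_mxEr.
apply/differentiable_rowP => j; case: (split_ordP j) => i ->.
  have := (differentiable_rowP F w).1 dF i; congr (differentiable _ _).
  by apply/funext => x; rewrite row_mxEl.
have := (differentiable_rowP G w).1 dG i; congr (differentiable _ _).
by apply/funext => x; rewrite row_mxEr.
Qed.

Lemma derive_row_mx (k N M : nat) (F : 'rV[R]_k -> 'rV[R]_N)
    (G : 'rV[R]_k -> 'rV[R]_M) w v :
  differentiable F w -> differentiable G w ->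
  'D_v (fun x => row_mx (F x) (G x)) w = row_mx ('D_v F w) ('D_v G w).
Proof.
move=> dF dG; have dFG := (differentiable_row_mx F G w).2 (conj dF dG).
apply/rowP => j; rewrite derive_coord//; case: (split_ordP j) => i ->.
  rewrite row_mxEl derive_coord//; congr ('D_v _ w).
  by apply/funext => x; rewrite row_mxEl.
rewrite row_mxEr derive_coord//; congr ('D_v _ w).
by apply/funext => x; rewrite row_mxEr.
Qed.

Lemma jacobian_eq (k N : nat) (F : 'rV[R]_k -> 'rV[R]_N) w A :
  differentiable F w -> (forall v, 'D_v F w = v *m A) -> 'J F w = A.
Proof.
by move=> dF H; apply/row_matrixP => i; rewrite !rowE -deriveEjacobian// H.
Qed.

Lemma open_lsubmx (k N : nat) (W : set 'rV[R]_k) :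
  open W -> open [set p : 'rV[R]_(k + N) | W (lsubmx p)].
Proof. by move=> oW; apply: open_comp => // x _; exact: continuous_lsubmx. Qed.

End DirectionalDerivatives.

(** * Charts and conormal spaces of a cylinder *)

Section CylinderGeometry.
Variables (R : realType) (k n : nat).
Implicit Types (M : set 'rV[R]_n) (V : set 'rV[R]_k) (f : 'rV[R]_k -> 'rV[R]_n).

Definition cylinder_param f : 'rV[R]_(k + 1) -> 'rV[R]_(n + 1) :=
  fun w => row_mx (f (lsubmx w)) (rsubmx w).

Lemma smooth_cylinder_map (a b : nat) (A : set 'rV[R]_a) (g : 'rV[R]_a -> 'rV[R]_b) :
  smooth_on A g ->
  smooth_on [set w | A (lsubmx w)]
    (fun w : 'rV[R]_(a + 1) => row_mx (g (lsubmx w)) (rsubmx w)).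
Proof.
move=> sg; apply: smooth_row_mx (@smooth_rsubmx _ _ _ _).
apply: (@smooth_on_comp _ _ _ _ [set w | A (lsubmx w)] A (@lsubmx R 1 a 1) g) => //.
exact: smooth_lsubmx.
Qed.

Lemma cylinder_local_param M V f : local_param M V f ->
  local_param (cylinder M) [set w | V (lsubmx w)] (cylinder_param f).
Proof.
move=> [oV sf [W [g [oW E sg gK]]]].
split; [exact: open_lsubmx|exact: smooth_cylinder_map|].
exists [set p | W (lsubmx p)], (fun p => row_mx (g (lsubmx p)) (rsubmx p)).
split.
- exact: open_lsubmx.
- apply/seteqP; split=> p /=.
    move=> [w Vw <-]; rewrite /cylinder /= row_mxKl.
    suff : (M `&` W) (f (lsubmx w)) by [].
    by rewrite -E; exists (lsubmx w).
  move=> [Mp Wp]; have : (f @` V) (lsubmx p) by rewrite E.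
  move=> [u Vu fu]; exists (row_mx u (rsubmx p)); first by rewrite /= row_mxKl.
  by rewrite /cylinder_param row_mxKl row_mxKr fu hsubmxK.
- exact: (@smooth_cylinder_map _ _ (M `&` W)).
- by move=> w Vw; rewrite /cylinder_param row_mxKl row_mxKr gK// hsubmxK.
Qed.

Lemma cylinder_submanifold M : submanifold k M -> submanifold (k + 1) (cylinder M).
Proof.
move=> sM p /sM [V [f [lp [u Vu fu]]]].
exists [set w | V (lsubmx w)], (cylinder_param f); split.
  exact: cylinder_local_param.
exists (row_mx u (rsubmx p)); first by rewrite /= row_mxKl.
by rewrite /cylinder_param row_mxKl row_mxKr fu hsubmxK.
Qed.

Lemma derive_rsubmx (a b : nat) (w v : 'rV[R]_(a + b)) :
  'D_v (fun x : 'rV[R]_(a + b) => rsubmx x) w = rsubmx v.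
Proof.
have rl (h : R) : @rsubmx R 1 a b (h *: v + w) = h *: rsubmx v + rsubmx w.
  by rewrite linearP.
have E := @derive_linear_comp R (a + b)%N b b (@rsubmx R 1 a b) id w v rl.
by rewrite derive_id in E.
Qed.

Lemma jacobian_cylinder M V f w : local_param M V f -> V (lsubmx w) ->
  'J (cylinder_param f) w = block_mx ('J f (lsubmx w)) 0 0 1%:M.
Proof.
move=> lp Vw; have df := local_param_differentiable lp Vw.
apply: jacobian_eq => [|v].
  exact: (local_param_differentiable (cylinder_local_param lp)).
rewrite derive_row_mx; last 2 first.
- by apply: differentiable_comp => //; exact: differentiable_lsubmx.
- exact: differentiable_rsubmx.
have -> : 'D_v (fun x : 'rV[R]_(k + 1) => f (lsubmx x)) w =
    'D_(lsubmx v) f (lsubmx w).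
  apply: (@derive_linear_comp R _ k n (@lsubmx R 1 k 1) f) => h.
  by rewrite linearP.
rewrite derive_rsubmx.
rewrite deriveEjacobian// -{3}[v]hsubmxK mul_row_block !mulmx0 mulmx1.
by rewrite addr0 add0r.
Qed.

Lemma conormal_cylinder M p xi : submanifold k M -> M (lsubmx p) ->
  conormal (k + 1) (cylinder M) p xi <->
  conormal k M (lsubmx p) (lsubmx xi) /\ rsubmx xi = 0.
Proof.
move=> sM Mp; have [V [f [lp [u Vu fu]]]] := sM _ Mp.
pose w : 'rV[R]_(k + 1) := row_mx u (rsubmx p).
have Vw : V (lsubmx w) by rewrite row_mxKl.
have pE : p = cylinder_param f w.
  by rewrite /cylinder_param row_mxKl row_mxKr fu hsubmxK.
have := conormalP xi (cylinder_local_param lp) Vw.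
rewrite -pE (jacobian_cylinder lp Vw) row_mxKl -fu.
have -> : xi *m (block_mx ('J f u) 0 0 1%:M)^T =
    row_mx (lsubmx xi *m ('J f u)^T) (rsubmx xi).
  rewrite tr_block_mx !trmx0 trmx1 -{1}[xi]hsubmxK mul_row_block.
  by rewrite !mulmx0 mulmx1 addr0 add0r.
move=> H; split=> [/H|[/(conormalP _ lp Vu) E1 E2]]; last first.
  by apply/H; rewrite E1 E2 row_mx0.
rewrite -(row_mx0 _ 1 k 1) => /eq_row_mx[E1 E2]; split=> //.
by apply/(conormalP _ lp Vu).
Qed.

End CylinderGeometry.

Lemma cylinder_formE (R : realType) n (mu : 'rV[R]_n -> 'rV[R]_n) (m : R -> R)
    a b p : (forall t, m t = a * t + b) ->
  cylinder_form mu m p = row_mx (mu (lsubmx p)) (a *: rsubmx p + b%:M).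
Proof.
move=> mE; congr row_mx; apply/rowP => j.
by rewrite !ord1 /tcoord mE !mxE eqxx !mulr1n.
Qed.

(** * The twisted conormal bundle *)

Section AdaptedFrame.
Variables (R : realType) (n' : nat).
Local Notation n := (2 + n')%N.

(** Complete a basis of the row space of [J] to a basis of [R^n]: [T0] and [N0] are its two parts,
    and [K1], [K0] the matching columns of the inverse. The rows of [T0] span those of [J], so
    [T0 *m J^T] is a Gram matrix up to an invertible factor. *)
Lemma adapted_complement (J : 'M[R]_(2, n)) (C : 'M[R]_(n, 2)) :
  J *m C = 1%:M ->
  exists (T0 : 'M[R]_(2, n)) (N0 : 'M[R]_(n', n)) (K1 : 'M[R]_(n, 2))
    (K0 : 'M[R]_(n, n')),
    [/\ T0 *m K0 = 0, N0 *m K0 = 1%:M, K1 *m T0 + K0 *m N0 = 1%:M &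
        T0 *m J^T \in unitmx].
Proof.
move=> JC; have rJ : \rank J = 2.
  by apply/eqP; apply/row_freeP; exists C.
pose E := row_ebase J.
have uE : E \in unitmx by exact: row_ebase_unit.
exists (usubmx E), (dsubmx E), (lsubmx (invmx E)), (rsubmx (invmx E)).
have EV : block_mx (usubmx E *m lsubmx (invmx E)) (usubmx E *m rsubmx (invmx E))
    (dsubmx E *m lsubmx (invmx E)) (dsubmx E *m rsubmx (invmx E)) = 1%:M.
  by rewrite -mul_col_row vsubmxK hsubmxK mulmxV.
have [_ E01 _ E11] := eq_block_mx (etrans EV (scalar_mx_block _ _ _)).
split=> //.
  by rewrite -mul_row_col vsubmxK hsubmxK mulVmx.
have JE : J = col_ebase J *m usubmx E.
  rewrite -{1}(mulmx_ebase J) rJ pid_mx_row -mulmxA -/E -{1}[E]vsubmxK.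
  by rewrite mul_row_col mul1mx mul0mx addr0.
have uC : col_ebase J \in unitmx by exact: col_ebase_unit.
have -> : usubmx E = invmx (col_ebase J) *m J by rewrite {2}JE mulKmx.
by rewrite -mulmxA unitmx_mul unitmx_inv uC (gram_unitmx JC).
Qed.

(* The basis of the normal space adapted to the splitting of [R^n] given by
   the rows of [T0] and [N0]: [nu] is [N0] corrected along [T0]. *)
Definition normal_frame (T0 : 'M[R]_(2, n)) (N0 : 'M[R]_(n', n))
    (J : 'M[R]_(2, n)) : 'M[R]_(n', n) :=
  N0 - N0 *m J^T *m invmx (T0 *m J^T) *m T0.

Variables (T0 : 'M[R]_(2, n)) (N0 : 'M[R]_(n', n)).
Variables (K1 : 'M[R]_(n, 2)) (K0 : 'M[R]_(n, n')) (J : 'M[R]_(2, n)).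
Hypotheses (TK : T0 *m K0 = 0) (NK : N0 *m K0 = 1%:M).
Hypotheses (KT : K1 *m T0 + K0 *m N0 = 1%:M) (uT : T0 *m J^T \in unitmx).

Lemma normal_frame_normal : normal_frame T0 N0 J *m J^T = 0.
Proof. by rewrite mulmxBl -!mulmxA mulVmx// mulmx1 subrr. Qed.

(** The correction lies in the span of [T0], which [K0] kills. Thus a constant matrix reads off
    frame coefficients whatever [J] is, and the inverse chart below is smooth. *)
Lemma normal_frame_coord : normal_frame T0 N0 J *m K0 = 1%:M.
Proof. by rewrite mulmxBl -!mulmxA TK !mulmx0 subr0. Qed.

(** Split [xi] along [T0] and [N0]. Orthogonality to [J] together with invertibility of [T0 *m J^T]
    forces the [T0] part to be the correction belonging to the [N0] part. *)
Lemma normal_frame_span (xi : 'rV[R]_n) : xi *m J^T = 0 ->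
  xi = xi *m K0 *m normal_frame T0 N0 J.
Proof.
move=> xJ; have xE : xi = xi *m K1 *m T0 + xi *m K0 *m N0.
  by rewrite -!mulmxA -mulmxDr KT mulmx1.
have : xi *m K1 *m (T0 *m J^T) = - (xi *m K0 *m N0 *m J^T).
  by apply/eqP; rewrite -addr_eq0 mulmxA -mulmxDl -xE xJ.
move=> /(congr1 (fun X => X *m invmx (T0 *m J^T))); rewrite mulmxK// => x1.
rewrite [LHS]xE x1 /normal_frame mulmxBr addrC !mulNmx.
by rewrite !mulmxA.
Qed.

End AdaptedFrame.

(** * Charts of the twisted conormal bundle and their Jacobians *)

Section TwistedConormal.
Variables (R : realType) (n' : nat).
Local Notation n := (2 + n')%N.
Variables (M : set 'rV[R]_n) (mu : 'rV[R]_n -> 'rV[R]_n).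
Variables (V : set 'rV[R]_2) (f : 'rV[R]_2 -> 'rV[R]_n).
Hypotheses (sM : submanifold 2 M) (smu : smooth_on M mu).
Hypothesis lp : local_param M V f.
Variables (T0 : 'M[R]_(2, n)) (N0 : 'M[R]_(n', n)).
Variables (K1 : 'M[R]_(n, 2)) (K0 : 'M[R]_(n, n')).
Hypotheses (TK : T0 *m K0 = 0) (NK : N0 *m K0 = 1%:M).
Hypothesis KT : K1 *m T0 + K0 *m N0 = 1%:M.
Hypothesis uT : forall u, V u -> T0 *m ('J f u)^T \in unitmx.
Variables (m : R -> R) (a b : R).
Hypothesis mE : forall t, m t = a * t + b.

Let nu u := normal_frame T0 N0 ('J f u).

Definition fiber_map (p : 'rV[R]_(2 + n')) : 'rV[R]_n :=
  rsubmx p *m nu (lsubmx p) + mu (f (lsubmx p)).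

Definition conormal_param (w : 'rV[R]_(n + 1)) : 'rV[R]_((n + 1) + (n + 1)) :=
  row_mx (row_mx (f (lsubmx (lsubmx w))) (rsubmx w))
         (row_mx (fiber_map (lsubmx w)) (a *: rsubmx w + b%:M)).

Definition conormal_domain : set 'rV[R]_(n + 1) :=
  [set w | V (lsubmx (lsubmx w))].

Let oV : open V. Proof. by case: lp. Qed.
Let sf : smooth_on V f. Proof. by case: lp. Qed.

Lemma smooth_nu : smooth_mx V nu.
Proof.
have sJ : smooth_mx V (fun u => ('J f u)^T).
  exact: smooth_mxT (smooth_jacobian oV sf).
apply: smooth_mxD; first exact: smooth_mx_cst.
apply: smooth_mxN; apply: smooth_mxM; last exact: smooth_mx_cst.
apply: smooth_mxM; first by apply: smooth_mxM sJ; exact: smooth_mx_cst.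
apply: smooth_invmx => //.
by apply: smooth_mxM sJ; exact: smooth_mx_cst.
Qed.

Lemma smooth_fiber_map :
  smooth_on [set p | V (lsubmx p)] fiber_map.
Proof.
apply/smooth_mx_row; apply: smooth_mxD.
  apply: smooth_mxM; first by apply/smooth_mx_row; exact: smooth_rsubmx.
  apply: (@smooth_mx_comp _ _ _ _ _ [set p | V (lsubmx p)] V
    (@lsubmx R 1 2 n') nu) => //; [exact: smooth_lsubmx|exact: smooth_nu].
apply/smooth_mx_row.
have sl : smooth_on [set p : 'rV[R]_(2 + n') | V (lsubmx p)] (f \o lsubmx).
  by apply: (@smooth_on_comp _ _ _ _ _ V) => //; exact: smooth_lsubmx.
apply: (@smooth_on_comp _ _ _ _ _ M (f \o lsubmx) mu) => // p Vp.
exact: local_param_mem lp Vp.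
Qed.

Lemma open_conormal_domain : open conormal_domain.
Proof. exact: (open_lsubmx (open_lsubmx oV)). Qed.

Lemma smooth_conormal_param : smooth_on conormal_domain conormal_param.
Proof.
have sl : smooth_on conormal_domain (@lsubmx R 1 n 1) by exact: smooth_lsubmx.
have sll : smooth_on conormal_domain
    (fun w : 'rV[R]_(n + 1) => lsubmx (lsubmx w) : 'rV[R]_2).
  apply: (@smooth_on_comp _ _ _ _ conormal_domain setT (@lsubmx R 1 n 1)
    (@lsubmx R 1 2 n')) => //; exact: smooth_lsubmx.
apply: smooth_row_mx; apply: smooth_row_mx.
- by apply: (@smooth_on_comp _ _ _ _ conormal_domain V _ f).
- exact: smooth_rsubmx.
- apply: (@smooth_on_comp _ _ _ _ conormal_domain [set p | V (lsubmx p)]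
    (@lsubmx R 1 n 1) fiber_map) => //; exact: smooth_fiber_map.
apply: (smooth_on_ext _ (_ : smooth_on _
  (fun w => rsubmx w *m (a%:M : 'M[R]_1) + b%:M))).
  by move=> w _; rewrite mul_mx_scalar.
apply/smooth_mx_row; apply: smooth_mxD; last exact: smooth_mx_cst.
apply: smooth_mxM; last exact: smooth_mx_cst.
by apply/smooth_mx_row; exact: smooth_rsubmx.
Qed.

Lemma conormal_param_onto p u :
  twisted_conormal 3 (cylinder M) (cylinder_form mu m) p -> V u ->
  f u = lsubmx (lsubmx p) ->
  exists2 w, conormal_domain w & conormal_param w = p.
Proof.
move=> [x [xi [Mx cxi ->]]] Vu; rewrite row_mxKl => fu.
have [] := (@conormal_cylinder R 2 n M x xi sM Mx).1 cxi.
rewrite -fu => /(conormalP _ lp Vu) cx xi0.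
exists (row_mx (row_mx u (lsubmx xi *m K0)) (rsubmx x)).
  by rewrite /conormal_domain /= !row_mxKl.
rewrite /conormal_param /fiber_map !(row_mxKl, row_mxKr) (cylinder_formE _ _ mE).
rewrite fu hsubmxK; congr row_mx.
rewrite -[in RHS](hsubmxK xi) add_row_mx xi0 add0r -/(nu u).
by rewrite -(normal_frame_span KT (uT Vu) cx).
Qed.

Lemma conormal_local_param :
  local_param (twisted_conormal 3 (cylinder M) (cylinder_form mu m))
    conormal_domain conormal_param.
Proof.
have Mf := local_param_mem lp.
split; [exact: open_conormal_domain|exact: smooth_conormal_param|].
have [_ _ [W [g [oW E sg gK]]]] := lp.
have MW v : V v -> (M `&` W) (f v) by move=> Vv; rewrite -E; exists v.
(* Inverse chart: [g] gives the surface coordinates, the covector part minus [mu] is normal and [K0]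
   returns its frame coefficients, and the line coordinate comes from the base point. *)
exists [set p | W (lsubmx (lsubmx p))], (fun p =>
  let x := lsubmx (lsubmx p) in
  row_mx (row_mx (g x) ((lsubmx (rsubmx p) - mu x) *m K0)) (rsubmx (lsubmx p))).
split.
- exact: (open_lsubmx (open_lsubmx oW)).
- apply/seteqP; split=> p.
    move=> [w Vw <-]; rewrite /conormal_domain /= in Vw; split; last first.
      by rewrite /= !row_mxKl; have [] := MW _ Vw.
    exists (row_mx (f (lsubmx (lsubmx w))) (rsubmx w)).
    exists (row_mx (rsubmx (lsubmx w) *m nu (lsubmx (lsubmx w))) 0); split.
    + by rewrite /cylinder /= row_mxKl; exact: Mf.
    + apply/(@conormal_cylinder R 2 n) => //; rewrite ?row_mxKl; first exact: Mf.
      rewrite row_mxKr; split=> //; apply/(conormalP _ lp Vw).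
      by rewrite -mulmxA normal_frame_normal ?mulmx0//; exact: uT.
    + by rewrite (cylinder_formE _ _ mE) row_mxKl row_mxKr add_row_mx add0r.
  move=> [Lp Wp]; have : (f @` V) (lsubmx (lsubmx p)).
    rewrite E; split=> //; move: Lp => [x [xi [Mx _ ->]]].
    by rewrite row_mxKl.
  by move=> [u Vu fu]; have [w Vw <-] := conormal_param_onto Lp Vu fu; exists w.
- set A := (_ `&` _).
  have AM p : A p -> (M `&` W) (lsubmx (lsubmx p)).
    move=> [[x [xi [Mx _ ->]]] Wx]; split; last by [].
    by rewrite row_mxKl.
  have sl : smooth_on A (fun p => lsubmx (lsubmx p) : 'rV[R]_n).
    apply: (@smooth_on_comp _ _ _ _ A setT (@lsubmx R 1 (n + 1) (n + 1))
      (@lsubmx R 1 n 1)) => //; exact: smooth_lsubmx.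
  apply: smooth_row_mx; last first.
    apply: (@smooth_on_comp _ _ _ _ A setT (@lsubmx R 1 (n + 1) (n + 1))
      (@rsubmx R 1 n 1)) => //; [exact: smooth_lsubmx|exact: smooth_rsubmx].
  apply: smooth_row_mx; first exact: (@smooth_on_comp _ _ _ _ A (M `&` W) _ g).
  apply/smooth_mx_row; apply: smooth_mxM; last exact: smooth_mx_cst.
  apply: smooth_mxD; last apply: smooth_mxN; apply/smooth_mx_row.
    apply: (@smooth_on_comp _ _ _ _ A setT (@rsubmx R 1 (n + 1) (n + 1))
      (@lsubmx R 1 n 1)) => //; [exact: smooth_rsubmx|exact: smooth_lsubmx].
  by apply: (@smooth_on_comp _ _ _ _ A M _ mu) => // p /AM[].
- move=> w Vw; rewrite /conormal_param /= !(row_mxKl, row_mxKr) gK//.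
  rewrite /fiber_map addrK -mulmxA normal_frame_coord ?mulmx1 ?hsubmxK//.
Qed.

(** The field [sigma] of the overview, with normal part of constant coefficients [s] in the adapted
    frame. *)
Definition shifted_section (s : 'rV[R]_n') (x : 'rV[R]_2) : 'rV[R]_n :=
  s *m normal_frame T0 N0 ('J f x) + mu (f x).

Lemma differentiable_shifted_section s x : V x -> differentiable (shifted_section s) x.
Proof.
move=> Vx; have ss : smooth_on V (shifted_section s).
  apply: (smooth_on_ext _ (_ : smooth_on _ (fiber_map \o (fun x => row_mx x s)))).
    by move=> y _; rewrite /fiber_map /= row_mxKl row_mxKr.
  apply: (@smooth_on_comp _ _ _ _ _ [set p | V (lsubmx p)] _ _ _ _ smooth_fiber_map).
    by move=> y Vy; rewrite /= row_mxKl.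
  apply/smooth_row_mx; last by apply/smooth_mx_row; exact: smooth_mx_cst.
  apply: (smooth_on_ext _ (@smooth_linear R 2 2 V 1%:M)) => y _.
  by rewrite mulmx1.
exact: (smooth_differentiable oV ss).
Qed.

(** By linearity of the differential it is enough to move [u] with the fibre coefficients frozen,
    and then the coefficients with [u] frozen, where the map is affine. *)
Lemma derive_fiber_map p q : V (lsubmx p) ->
  'D_q fiber_map p =
  lsubmx q *m 'J (shifted_section (rsubmx p)) (lsubmx p) + rsubmx q *m nu (lsubmx p).
Proof.
move=> Vp; have dfm : differentiable fiber_map p.
  exact: (smooth_differentiable (open_lsubmx oV) smooth_fiber_map).
have qE : q = row_mx (lsubmx q) 0 + row_mx 0 (rsubmx q).
  by rewrite add_row_mx addr0 add0r hsubmxK.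
rewrite (deriveE _ dfm) {1}qE linearD -!(deriveE _ dfm); congr (_ + _).
  rewrite -(deriveEjacobian _ (differentiable_shifted_section _ Vp)).
  apply: derive_along => h.
  rewrite /fiber_map !linearP /= !(row_mxKl, row_mxKr) scaler0 add0r.
  by rewrite addrC.
rewrite -(derive_affine (nu (lsubmx p)) (mu (f (lsubmx p))) (rsubmx p)).
apply: derive_along => h.
by rewrite /fiber_map !linearP /= !(row_mxKl, row_mxKr) scaler0 add0r.
Qed.

Lemma jacobian_conormal_param w : conormal_domain w ->
  let u := lsubmx (lsubmx w) in
  'J conormal_param w = row_mx (frame_x ('J f u))
    (frame_y ('J (shifted_section (rsubmx (lsubmx w))) u) (nu u) a).
Proof.
move=> Vw u; have Vu : V u := Vw.
have dc : differentiable conormal_param w.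
  exact: (smooth_differentiable open_conormal_domain smooth_conormal_param).
have [/differentiable_row_mx[d1 d2] /differentiable_row_mx[d3 d4]] :=
  (differentiable_row_mx _ _ w).1 dc.
apply: (jacobian_eq dc) => v.
rewrite derive_row_mx; [|exact/differentiable_row_mx..].
rewrite (derive_row_mx _ d1 d2) (derive_row_mx _ d3 d4) mul_mx_row.
have vE : v = row_mx (row_mx (lsubmx (lsubmx v)) (rsubmx (lsubmx v))) (rsubmx v).
  by rewrite !hsubmxK.
rewrite [in RHS]vE mul_frame_x mul_frame_y.
have l1 (h : R) : lsubmx (h *: v + w) = h *: lsubmx v + lsubmx w :> 'rV[R]_n.
  by rewrite linearP.
have ll (h : R) : lsubmx (lsubmx (h *: v + w)) =
    h *: lsubmx (lsubmx v) + u :> 'rV[R]_2.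
  by rewrite l1 linearP.
have r1 (h : R) : rsubmx (h *: v + w) = h *: rsubmx v + rsubmx w :> 'rV[R]_1.
  by rewrite linearP.
congr (row_mx (row_mx _ _) (row_mx _ _)).
- rewrite -(deriveEjacobian _ (local_param_differentiable lp Vu)).
  by apply: derive_along => h; rewrite ll.
- exact: derive_rsubmx.
- rewrite -(derive_fiber_map _ Vu).
  by apply: derive_along => h; rewrite l1.
- rewrite -(derive_affine a%:M b%:M (rsubmx w)).
  by apply: derive_along => h; rewrite r1 mul_mx_scalar.
Qed.

End TwistedConormal.

(** * The special Lagrangian condition *)

Lemma mulmx_tr_dotv (R : realType) p q N (A : 'M[R]_(p, N))
    (B : 'M[R]_(q, N)) i j :
  (A *m B^T) i j = dotv (row i A) (row j B).
Proof. by rewrite mxE; apply: eq_bigr => l _; rewrite !mxE. Qed.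

Section Forms.
Import complex.
Variable R : realType.

Lemma kahler_formE N (v w : 'rV[R]_(N + N)) :
  kahler_form v w = dotv (lsubmx v) (rsubmx w) - dotv (lsubmx w) (rsubmx v).
Proof. by rewrite /kahler_form sumrB. Qed.

Lemma kahler_form_frame N (X Y : 'M[R]_N) (h h' : 'rV[R]_N) :
  (X *m Y^T)^T = X *m Y^T ->
  kahler_form (h *m row_mx X Y) (h' *m row_mx X Y) = 0.
Proof.
move=> XY; rewrite kahler_formE !mul_mx_row !row_mxKl !row_mxKr !dotvE.
rewrite !trmx_mul !mulmxA -(mulmxA h) -(mulmxA h') -XY.
have -> : (h' *m (X *m Y^T)^T *m h^T) = (h *m (X *m Y^T) *m h'^T)^T.
  by rewrite !trmx_mul !trmxK !mulmxA.
by rewrite [X in _ - X]mxE XY subrr.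
Qed.

Lemma Im_mulCA_real (w z : R[i]) (x : R) :
  complex.Im (w * (real_complex R x * z)) = x * complex.Im (w * z).
Proof. by rewrite mulrCA ImM_real. Qed.

(** Vectors in the real span of the frame change the complex volume only by a real determinant, so
    the phase condition need only be checked on the frame. *)
Lemma holo_volume_frame N (X Y : 'M[R]_N) (H : 'M[R]_N)
    (v : 'I_N -> 'rV[R]_(N + N)) :
  (forall i, v i = row i H *m row_mx X Y) ->
  holo_volume v = real_complex R (\det H) *
    \det (map_mx (real_complex R) X +
      Complex (0 : R) 1 *: map_mx (real_complex R) Y).
Proof.
move=> vE; rewrite /holo_volume -det_map_mx -det_mulmx mulmxDr -scalemxAr.
rewrite -!map_mxM; congr (\det _); apply/matrixP => i j.
rewrite mxE /dz /dx /dy vE mul_mx_row row_mxKl row_mxKr -!row_mul.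
rewrite [RHS]mxE [X in _ = X + _]mxE [X in _ = _ + X]mxE [X in _ = _ + _ * X]mxE.
rewrite ![(row i _) 0 j]mxE; move: ((H *m X) i j) ((H *m Y) i j) => x y.
apply/eqP; rewrite eq_complex /=.
by rewrite !(mul0r, mul1r, add0r, subrr, subr0, addr0) !eqxx.
Qed.

End Forms.

Section SpecialLagrangian.
Variables (R : realType) (n' : nat).
Local Notation n := (2 + n')%N.
Variables (M : set 'rV[R]_n) (mu : 'rV[R]_n -> 'rV[R]_n).
Hypotheses (minM : minimal 2 M) (harm : harmonic_form 2 M mu).
Variables (m : R -> R) (a b : R).
Hypothesis mE : forall t, m t = a * t + b.

Lemma shifted_hessian V f (T0 : 'M[R]_(2, n)) (N0 : 'M[R]_(n', n)) s u i j :
  local_param M V f -> (forall x, V x -> T0 *m ('J f x)^T \in unitmx) -> V u ->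
  ('J (shifted_section mu f T0 N0 s) u *m ('J f u)^T) i j =
  partialR i (coef f mu j) u -
  dotv (s *m normal_frame T0 N0 ('J f u) + mu (f u)) (partial i (partial j f) u).
Proof.
move=> lp uT Vu; have [oV sf _] := lp; have [[smu _] _ _] := harm.
have ds := differentiable_shifted_section smu lp N0 uT s Vu.
have df : differentiable f u := local_param_differentiable lp Vu.
have dpf : differentiable (partial j f) u.
  by apply: (smooth_differentiable oV _ Vu); exact: smooth_partial.
have [_ ] := derivable_dotv (delta_mx 0 i) ds dpf.
have -> : ('J (shifted_section mu f T0 N0 s) u *m ('J f u)^T) i j =
    dotv (partial i (shifted_section mu f T0 N0 s) u) (partial j f u).
  by rewrite -(row_jacobian i ds) -(row_jacobian j df) mulmx_tr_dotv.
move=> E; apply: (addIr (dotv (shifted_section mu f T0 N0 s u)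
  (partial i (partial j f) u))); apply: etrans (esym E) _.
rewrite subrK.
apply: near_eq_derive; apply: (open_near oV Vu) => x Vx.
have dfx : differentiable f x := local_param_differentiable lp Vx.
(* The normal part drops out at every [x] near [u], so the pairing of the section with [partial j f]
   and [coef f mu j] agree locally and have the same derivative. *)
have z : dotv (s *m normal_frame T0 N0 ('J f x)) (partial j f x) = 0.
  rewrite -(row_jacobian j dfx) dotvE tr_row colE mulmxA -(mulmxA s).
  by rewrite (normal_frame_normal N0 (uT x Vx)) mulmx0 mul0mx mxE.
by rewrite /shifted_section dotvDl z add0r.
Qed.

(** Reduces the geometry at a point to matrices: a chart through [p], a frame spanning the tangent
    vectors, and the algebraic hypotheses of [frame_lagrangian] and [frame_phase]. *)
Lemma twisted_conormal_at p
    (L := twisted_conormal 3 (cylinder M) (cylinder_form mu m)) :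
  L p ->
  exists (J D : 'M[R]_(2, n)) (Nu : 'M[R]_(n', n)) (K0 : 'M[R]_(n, n')),
    [/\ exists V f, local_param (k := n + 1) L V f /\ (f @` V) p,
        forall v, tangent (n + 1) L p v ->
          exists h, v = h *m row_mx (frame_x J) (frame_y D Nu a),
        Nu *m J^T = 0 /\ Nu *m K0 = 1%:M,
        J *m J^T \in unitmx /\ (D *m J^T)^T = D *m J^T &
        \sum_i \sum_j invmx (J *m J^T) i j * (D *m J^T) i j = 0].
Proof.
move=> Lp; have sM := minM.1; have [[smu _] _ _] := harm.
have [x [xi [Mx _ pE]]] := Lp.
have [V [f [lp [u0 Vu0 fu0]]]] := sM _ Mx.
have [C JC] := jacobian_rinv lp Vu0.
have [T0 [N0 [K1 [K0 [TK NK KT uT0]]]]] := adapted_complement JC.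
have [oV sf _] := lp.
have sJ : smooth_mx V (fun u => ('J f u)^T).
  exact: smooth_mxT (smooth_jacobian oV sf).
have sdet : smoothR_on V (fun u => \det (T0 *m ('J f u)^T)).
  by apply: smooth_det; apply: smooth_mxM sJ; exact: smooth_mx_cst.
(* The splitting is adapted at [u0] only. Invertibility of [T0 *m ('J f u)^T] is an open condition,
   so the normal frame survives on a smaller chart domain. *)
pose V' := V `&` (fun u => \det (T0 *m ('J f u)^T)) @^-1` [set d | d != 0].
have oV' : open V'.
  apply: open_preimage_on => //.
  move=> u Vu; apply: differentiable_continuous.
  exact: smoothR_differentiable sdet Vu.
have lp' : local_param M V' f by apply: local_param_restrict lp oV' _ => u [].
have uT u : V' u -> T0 *m ('J f u)^T \in unitmx.
  by move=> [_ /= d0]; rewrite unitmxE unitfE.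
have lpL := conormal_local_param sM smu lp' TK NK KT uT mE.
have V'u0 : V' u0 by split=> //=; move: uT0; rewrite unitmxE unitfE.
have fu0' : f u0 = lsubmx (lsubmx p) by rewrite pE row_mxKl.
have [w Vw wp] := conormal_param_onto sM lp' KT uT mE Lp V'u0 fu0'.
have sl := jacobian_conormal_param smu lp' N0 uT a b Vw.
set u := lsubmx (lsubmx w) in sl; set s := rsubmx (lsubmx w) in sl.
have V'u : V' u := Vw.
exists ('J f u), ('J (shifted_section mu f T0 N0 s) u),
  (normal_frame T0 N0 ('J f u)), K0; split.
- exists (conormal_domain V'), (conormal_param mu f T0 N0 a b).
  by split=> //; exists w.
- by move=> v; rewrite -wp => /(tangentP _ lpL Vw)[h ->]; exists h; rewrite sl.
- split; first exact: normal_frame_normal (uT u V'u).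
  exact: normal_frame_coord.
- split; first exact: first_ff_unit lp' V'u.
  apply/matrixP => i j; rewrite mxE.
  exact: (etrans (shifted_hessian N0 s j i lp' uT V'u)
    (etrans (hessian_symmetric harm lp' V'u _ j i)
      (esym (shifted_hessian N0 s i j lp' uT V'u)))).
have nN : s *m normal_frame T0 N0 ('J f u) *m ('J f u)^T = 0.
  by rewrite -mulmxA (normal_frame_normal N0 (uT u V'u)) mulmx0.
rewrite -[RHS](hessian_traceless minM harm lp' V'u nN).
apply: eq_bigr => i _; apply: eq_bigr => j _.
exact: (congr1 _ (shifted_hessian N0 s i j lp' uT V'u)).
Qed.

End SpecialLagrangian.

Lemma affine_derive (R : realType) (m : R -> R) (a b c : R) :
  (forall t, m t = a * t + b) -> (forall t : R, is_derive t 1 m c) -> a = c.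
Proof.
move=> mE /(_ 0)[_ <-]; apply/esym/lim_near_cst => //=; near=> h.
rewrite !mE /= addr0 mulr0 add0r addrK [h *: 1]mulr1 /GRing.scale /=.
rewrite mulrCA mulVf ?mulr1//.
by near: h; exact: nbhs_dnbhs_neq.
Unshelve. all: by end_near. Qed.

Lemma surface_dimension (R : realType) (n : nat) (M : set 'rV[R]_n) x :
  submanifold 2 M -> M x -> exists n', n = (2 + n')%N.
Proof.
move=> sM /sM [V [f [lp [u Vu _]]]]; have [B JB] := jacobian_rinv lp Vu.
have /eqP r2 : row_free ('J f u) by apply/row_freeP; exists B.
by exists (n - 2)%N; rewrite subnKC// -r2 rank_leq_col.
Qed.

Theorem theorem5p2 (R : realType) (n : nat) (phi : R)
  (hphi : cos phi != 0)
  (Sigma : set 'rV[R]_n) (hSigma : minimal 2 Sigma)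
  (mu : 'rV[R]_n -> 'rV[R]_n) (hmu : harmonic_form 2 Sigma mu)
  (m : R -> R) (hm : exists a b : R, forall t, m t = a * t + b)
  (hm' : forall t : R, is_derive t 1 m (- tan phi)) :
  twisted_austere 3 (phi + (n%:R - 2) * (pi / 2))
    (cylinder Sigma) (cylinder_form mu m).
Proof.
have [a [b mE]] := hm; have aE := affine_derive mE hm'.
have sS := hSigma.1; have [[smu muT] _ _] := hmu.
have onef : one_form 3 (cylinder Sigma) (cylinder_form mu m).
  split.
    apply: (smooth_on_ext _ (_ : smooth_on _
      (fun p => row_mx (mu (lsubmx p)) (rsubmx p *m (a%:M : 'M[R]_1) + b%:M)))).
      by move=> p _; rewrite (cylinder_formE _ _ mE) mul_mx_scalar.
    apply: smooth_row_mx.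
      apply: (@smooth_on_comp _ _ _ _ _ Sigma (@lsubmx R 1 n 1) mu) => //.
      exact: smooth_lsubmx.
    apply/smooth_mx_row; apply: smooth_mxD; last exact: smooth_mx_cst.
    apply: smooth_mxM; last exact: smooth_mx_cst.
    by apply/smooth_mx_row; exact: smooth_rsubmx.
  move=> p Sp nu /(@conormal_cylinder R 2 n _ _ _ sS Sp)[cn nu0].
  rewrite (cylinder_formE _ _ mE) dotvE -[nu]hsubmxK nu0 tr_row_mx mul_row_col.
  by rewrite trmx0 mulmx0 addr0 -dotvE; exact: muT.
split=> //; first exact: (@cylinder_submanifold R 2 n).
clear onef smu muT sS.
(* An empty [Sigma] is allowed with [n < 2], so [n = 2 + n'] is drawn from a point; everything left
   to prove is pointwise. The rank of the chart's Jacobian is 2, which bounds [n] from below. *)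
have dimE p : twisted_conormal 3 (cylinder Sigma) (cylinder_form mu m) p ->
    exists n', n = (2 + n')%N.
  by move=> [x [xi [Sx _ _]]]; exact: surface_dimension hSigma.1 Sx.
split=> p Lp; have [n' n'E] := dimE p Lp; subst n.
  by have [J [D [Nu [K0 []]]]] := twisted_conormal_at hSigma hmu mE Lp.
have [J [D [Nu [K0 [_ tE [NJ NK] [uG symH] trH]]]]] :=
  twisted_conormal_at hSigma hmu mE Lp.
split=> [v w /tE[h ->] /tE[h' ->]|v /(_ _)/tE tv].
  exact/kahler_form_frame/frame_lagrangian.
(* Tangency yields frame coefficients for each vector separately; collected as the rows of a matrix,
   they supply the real determinant factor. *)
have [h hv] := choice tv.
have vE i : v i = row i (\matrix_i h i) *m row_mx (frame_x J) (frame_y D Nu a).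
  by rewrite rowK hv.
rewrite (holo_volume_frame vE) Im_mulCA_real aE.
by rewrite (frame_phase NJ NK uG symH trH hphi) mulr0.
Qed.
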